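(* Let $L$ be a restricted Lie algebra over an infinite perfect field $\mathbb{F}$ of characteristic $p>0$. If $L$ is algebraically generated and its restricted enveloping algebra $u(L)$ is a GI-algebra, then $u(L)$ is locally finite.
   Context: $u(L)$ denotes the restricted enveloping algebra of $L$, and $x\mapsto x^{[p]}$ the $p$-map of $L$. An element $x\in L$ is algebraic with respect to the $p$-map if there are $n\ge 0$ and $\alpha_0,\ldots,\alpha_n\in\mathbb{F}$, not all zero, with $\sum_{i=0}^n\alpha_i x^{[p]^i}=0$. $L$ is algebraically generated if it is generated, as a restricted Lie algebra, by elements that are algebraic with respect to the $p$-map. A unital associative algebra $A$ is a GI-algebra if its group of units $A^\times$ satisfies a group identity, i.e. there is a nontrivial word $w(x_1,\ldots,x_n)$ in a free group with $w(g_1,\ldots,g_n)=1$ for all $g_1,\ldots,g_n\in A^\times$. An associative algebra is locally finite if every finitely generated subalgebra is finite-dimensional over the ground field. *)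

(* Defs.v *)
From HB Require Import structures.
From mathcomp Require Import all_boot all_order all_algebra.
From mathcomp Require Import generic_quotient.
From mathcomp Require Import boolp classical_sets cardinality.

Set Implicit Arguments.
Unset Strict Implicit.
Unset Printing Implicit Defensive.

Import GRing.Theory.
Local Open Scope ring_scope.
Local Open Scope classical_set_scope.

HB.mixin Record Lmodule_isLie (F : fieldType) L of GRing.Lmodule F L := {
  lie : L -> L -> L;
  lieDl : forall x y z, lie (x + y) z = lie x z + lie y z;
  lieDr : forall x y z, lie x (y + z) = lie x y + lie x z;
  lieZl : forall a x y, lie (a *: x) y = a *: lie x y;
  lieZr : forall a x y, lie x (a *: y) = a *: lie x y;
  liexx : forall x, lie x x = 0;
  lie_jacobi : forall x y z,
    lie x (lie y z) + lie y (lie z x) + lie z (lie x y) = 0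
}.

#[short(type="lieAlgType")]
HB.structure Definition Lie (F : fieldType) :=
  {L of GRing.Lmodule F L & Lmodule_isLie F L}.

(* Jacobson's s_i(x, y): i * s_i(x, y) is the coefficient of t^(i-1) in
   ad(t x + y)^(p-1) (x), i.e. the sum of the [c_1, [c_2, ... [c_(p-1), x]]]
   over the words c in x and y with exactly i - 1 letters x. *)
Definition jacobson (F : fieldType) (L : lieAlgType F) (p : nat) (x y : L)
    (i : nat) : L :=
  i%:R^-1 *: \sum_(w : p.-1.-tuple bool | count id w == i.-1)
    foldr (fun b z => lie (if b then x else y) z) x w.

(* [ppow x] is x^[p]; the characteristic of F is not part of the structure. *)
HB.mixin Record Lie_isRestricted (F : fieldType) (p : nat) L of Lie F L := {
  ppow : L -> L;
  lie_ppow : forall x y : L, lie (ppow x) y = iter p (lie x) y;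
  ppowZ : forall (a : F) x, ppow (a *: x) = a ^+ p *: ppow x;
  ppowD : forall x y : L,
    ppow (x + y) = ppow x + ppow y + \sum_(1 <= i < p) jacobson p x y i
}.

#[short(type="restrictedLieType")]
HB.structure Definition RestrictedLie (F : fieldType) (p : nat) :=
  {L of Lie F L & Lie_isRestricted F p L}.

Arguments ppow {F p s} x.

Section RestrictedLieTheory.
Variables (F : fieldType) (p : nat) (L : restrictedLieType F p).

Definition restricted_subalgebra : set (set L) := [set S : set L |
  [/\ GRing.submod_closed (mem S),
      forall x y, S x -> S y -> S (lie x y)
    & forall x, S x -> S (ppow x)]].

Definition palgebraic (x : L) : Prop :=
  exists n (a : 'I_n.+1 -> F),
    (exists i, a i != 0) /\ \sum_(i < n.+1) a i *: iter i ppow x = 0.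

Definition algebraically_generated : Prop :=
  exists2 X : set L, X `<=` palgebraic
    & smallest restricted_subalgebra X = [set: L].

Definition restricted_rep (A : algType F) (f : L -> A) : Prop :=
  (forall x y, f (lie x y) = f x * f y - f y * f x) /\
  (forall x, f (ppow x) = f x ^+ p).

(* (U, iota) is a restricted enveloping algebra u(L) of L; existence is
   [restricted_enveloping_exists] below. *)
Definition restricted_enveloping (U : algType F) (iota : {linear L -> U}) :=
  restricted_rep iota /\
  forall (A : algType F) (f : {linear L -> A}), restricted_rep f ->
    exists g : {lrmorphism U -> A}, (forall x, g (iota x) = f x) /\
      forall h : {lrmorphism U -> A}, (forall x, h (iota x) = f x) -> h =1 g.

End RestrictedLieTheory.

Section GroupIdentity.

(* Words in the free group on n letters: the letter (i, false) is x_i and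
   (i, true) is its inverse. Nontrivial elements of the free group correspond
   to nonempty reduced words. *)
Definition group_word n := seq ('I_n * bool).

Definition reduced n (w : group_word n) : bool :=
  sorted (fun a b => ~~ ((a.1 == b.1) && (a.2 != b.2))) w.

Definition word_eval (R : nzRingType) n (g ginv : 'I_n -> R)
    (w : group_word n) : R :=
  \prod_(a <- w) (if a.2 then ginv a.1 else g a.1).

Definition GI_algebra (F : fieldType) (A : algType F) : Prop :=
  exists n (w : group_word n), [/\ w != [::], reduced w &
    forall g ginv : 'I_n -> A,
      (forall i, g i * ginv i = 1 /\ ginv i * g i = 1) ->
      word_eval g ginv w = 1].

End GroupIdentity.

Definition finite_dimensional (F : fieldType) (V : lmodType F) (B : set V) :=
  exists e : seq V,
    B = [set x | exists c : nat -> F, x = \sum_(i < size e) c i *: e`_i].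

Definition subalgebra (F : fieldType) (A : algType F) : set (set A) :=
  [set B : set A | GRing.subalg_closed (mem B)].

Definition locally_finite (F : fieldType) (A : algType F) : Prop :=
  forall s : seq A, finite_dimensional (smallest (@subalgebra F A) [set` s]).

Definition perfect_char (F : fieldType) (p : nat) : Prop :=
  forall x : F, exists y : F, y ^+ p = x.

Section RestrictedEnvelopingExists.
Variables (F : fieldType) (p : nat) (L : restrictedLieType F p).
Hypothesis p_gt0 : (0 < p)%N.

(* u(L) by generators and relations: formal algebra expressions in the elements
   of L, modulo the least congruence imposing the axioms of F-algebras and the
   relations making L -> u(L) a linear restricted representation. *)
Inductive uterm : Type :=
  | UGen of L | UZero | UOne | UOpp of uterm
  | UAdd of uterm & uterm | UMul of uterm & uterm | UScale of F & uterm.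

Inductive ucong : uterm -> uterm -> Prop :=
  | ucong_refl t : ucong t t
  | ucong_sym t u : ucong t u -> ucong u t
  | ucong_trans t u v : ucong t u -> ucong u v -> ucong t v
  | ucong_opp t t' : ucong t t' -> ucong (UOpp t) (UOpp t')
  | ucong_add t t' u u' :
      ucong t t' -> ucong u u' -> ucong (UAdd t u) (UAdd t' u')
  | ucong_mul t t' u u' :
      ucong t t' -> ucong u u' -> ucong (UMul t u) (UMul t' u')
  | ucong_scale a t t' : ucong t t' -> ucong (UScale a t) (UScale a t')
  | ucong_addA t u v : ucong (UAdd t (UAdd u v)) (UAdd (UAdd t u) v)
  | ucong_addC t u : ucong (UAdd t u) (UAdd u t)
  | ucong_add0 t : ucong (UAdd UZero t) t
  | ucong_addN t : ucong (UAdd (UOpp t) t) UZero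
  | ucong_mulA t u v : ucong (UMul t (UMul u v)) (UMul (UMul t u) v)
  | ucong_mul1l t : ucong (UMul UOne t) t
  | ucong_mul1r t : ucong (UMul t UOne) t
  | ucong_mulDl t u v : ucong (UMul (UAdd t u) v) (UAdd (UMul t v) (UMul u v))
  | ucong_mulDr t u v : ucong (UMul t (UAdd u v)) (UAdd (UMul t u) (UMul t v))
  | ucong_scaleA a b t : ucong (UScale a (UScale b t)) (UScale (a * b) t)
  | ucong_scale1 t : ucong (UScale 1 t) t
  | ucong_scaleDr a t u :
      ucong (UScale a (UAdd t u)) (UAdd (UScale a t) (UScale a u))
  | ucong_scaleDl a b t :
      ucong (UScale (a + b) t) (UAdd (UScale a t) (UScale b t))
  | ucong_scaleAl a t u : ucong (UScale a (UMul t u)) (UMul (UScale a t) u)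
  | ucong_scaleAr a t u : ucong (UScale a (UMul t u)) (UMul t (UScale a u))
  | ucong_genD x y : ucong (UGen (x + y)) (UAdd (UGen x) (UGen y))
  | ucong_genZ a x : ucong (UGen (a *: x)) (UScale a (UGen x))
  | ucong_lie x y : ucong (UGen (lie x y))
      (UAdd (UMul (UGen x) (UGen y)) (UOpp (UMul (UGen y) (UGen x))))
  | ucong_ppow x : ucong (UGen (ppow x)) (iter p (UMul (UGen x)) UOne).

HB.instance Definition _ := gen_eqMixin uterm.
HB.instance Definition _ := gen_choiceMixin uterm.

Definition ucongb (t u : uterm) : bool := `[< ucong t u >].

Lemma ucongb_equiv : equiv_class_of ucongb.
Proof.
split.
- by move=> t; apply/asboolP; exact: ucong_refl.
- move=> t u; apply/asboolP/asboolP; exact: ucong_sym.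
- move=> u t v /asboolP tu /asboolP uv; apply/asboolP.
  exact: ucong_trans tu uv.
Qed.

Canonical ucongb_equivRel := EquivRelPack ucongb_equiv.

Definition uenv := {eq_quot ucongb_equivRel}%qT.
HB.instance Definition _ := Choice.on uenv.
HB.instance Definition _ := Quotient.on uenv.

Definition upi (t : uterm) : uenv := (\pi_uenv t)%qT.

Lemma upiP t u : upi t = upi u <-> ucong t u.
Proof.
by split=> [/eqquotP /asboolP //|tu]; apply/eqquotP/asboolP.
Qed.

Lemma upi_repr (a : uenv) : upi (repr a) = a.
Proof. exact: reprK. Qed.

Lemma repr_upi t : ucong (repr (upi t)) t.
Proof. by apply/upiP; rewrite upi_repr. Qed.

Lemma upi_surj (a : uenv) : exists t, a = upi t.
Proof. by exists (repr a); rewrite upi_repr. Qed.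

Definition uopp (a : uenv) := upi (UOpp (repr a)).
Definition uadd (a b : uenv) := upi (UAdd (repr a) (repr b)).
Definition umul (a b : uenv) := upi (UMul (repr a) (repr b)).
Definition uscale (c : F) (a : uenv) := upi (UScale c (repr a)).

Lemma uoppE t : uopp (upi t) = upi (UOpp t).
Proof. by apply/upiP/ucong_opp/repr_upi. Qed.
Lemma uaddE t u : uadd (upi t) (upi u) = upi (UAdd t u).
Proof. by apply/upiP; apply: ucong_add; exact: repr_upi. Qed.
Lemma umulE t u : umul (upi t) (upi u) = upi (UMul t u).
Proof. by apply/upiP; apply: ucong_mul; exact: repr_upi. Qed.
Lemma uscaleE c t : uscale c (upi t) = upi (UScale c t).
Proof. by apply/upiP/ucong_scale/repr_upi. Qed.
Let uE := (uoppE, uaddE, umulE, uscaleE).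

Section Eval.
Variables (A : algType F) (f : L -> A).

Fixpoint ueval (t : uterm) : A :=
  match t with
  | UGen x => f x | UZero => 0 | UOne => 1 | UOpp t => - ueval t
  | UAdd t u => ueval t + ueval u | UMul t u => ueval t * ueval u
  | UScale c t => c *: ueval t
  end.

Lemma ueval_iter x n : ueval (iter n (UMul (UGen x)) UOne) = f x ^+ n.
Proof. by elim: n => [|n IHn] //=; rewrite IHn exprS. Qed.

Lemma ueval_cong t u : linear f -> restricted_rep f ->
  ucong t u -> ueval t = ueval u.
Proof.
move=> flin [flie fpow].
have fD x y : f (x + y) = f x + f y by have := flin 1 x y; rewrite !scale1r.
have f0 : f 0 = 0 by apply: (addIr (f 0)); rewrite -fD !add0r.
have fZ a x : f (a *: x) = a *: f x by rewrite -[a *: x]addr0 flin f0 addr0.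
elim=> {t u} //=.
- by move=> t u v _ -> _ ->.
- by move=> t u _ ->.
- by move=> t t' u u' _ -> _ ->.
- by move=> t t' u u' _ -> _ ->.
- by move=> a t t' _ ->.
- by move=> t u v; rewrite addrA.
- by move=> t u; rewrite addrC.
- by move=> t; rewrite add0r.
- by move=> t; rewrite addNr.
- by move=> t u v; rewrite mulrA.
- by move=> t; rewrite mul1r.
- by move=> t; rewrite mulr1.
- by move=> t u v; rewrite mulrDl.
- by move=> t u v; rewrite mulrDr.
- by move=> a b t; rewrite scalerA.
- by move=> t; rewrite scale1r.
- by move=> a t u; rewrite scalerDr.
- by move=> a b t; rewrite scalerDl.
- by move=> a t u; rewrite scalerAl.
- by move=> a t u; rewrite scalerAr.
- by move=> x; rewrite ueval_iter.
Qed.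

End Eval.

Lemma uaddA : associative uadd.
Proof.
move=> a b c.
case: (upi_surj a) (upi_surj b) (upi_surj c) => t -> [u ->] [v ->].
rewrite !uE; exact/upiP/ucong_addA.
Qed.
Lemma uaddC : commutative uadd.
Proof.
move=> a b; case: (upi_surj a) (upi_surj b) => t -> [u ->].
rewrite !uE; exact/upiP/ucong_addC.
Qed.
Lemma uadd0 : left_id (upi UZero) uadd.
Proof.
by move=> a; case: (upi_surj a) => t ->; rewrite !uE; exact/upiP/ucong_add0.
Qed.
Lemma uaddN : left_inverse (upi UZero) uopp uadd.
Proof.
by move=> a; case: (upi_surj a) => t ->; rewrite !uE; exact/upiP/ucong_addN.
Qed.
HB.instance Definition _ := GRing.isZmodule.Build uenv uaddA uaddC uadd0 uaddN.

Lemma umulA : associative umul.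
Proof.
move=> a b c.
case: (upi_surj a) (upi_surj b) (upi_surj c) => t -> [u ->] [v ->].
rewrite !uE; exact/upiP/ucong_mulA.
Qed.
Lemma umul1l : left_id (upi UOne) umul.
Proof.
by move=> a; case: (upi_surj a) => t ->; rewrite !uE; exact/upiP/ucong_mul1l.
Qed.
Lemma umul1r : right_id (upi UOne) umul.
Proof.
by move=> a; case: (upi_surj a) => t ->; rewrite !uE; exact/upiP/ucong_mul1r.
Qed.
Lemma umulDl : left_distributive umul uadd.
Proof.
move=> a b c.
case: (upi_surj a) (upi_surj b) (upi_surj c) => t -> [u ->] [v ->].
rewrite !uE; exact/upiP/ucong_mulDl.
Qed.
Lemma umulDr : right_distributive umul uadd.
Proof.
move=> a b c.
case: (upi_surj a) (upi_surj b) (upi_surj c) => t -> [u ->] [v ->].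
rewrite !uE; exact/upiP/ucong_mulDr.
Qed.
Lemma uone_neq0 : upi UOne != upi UZero.
Proof.
apply/eqP => /upiP/(@ueval_cong F^o (fun _ => 0))/= oz.
suff /eqP : (1 : F) = 0 by rewrite oner_eq0.
apply: oz => [a x y|]; first by rewrite scaler0 addr0.
by split=> [x y|x]; rewrite ?mul0r ?subr0 // expr0n eqn0Ngt p_gt0.
Qed.
HB.instance Definition _ := GRing.Zmodule_isNzRing.Build uenv
  umulA umul1l umul1r umulDl umulDr uone_neq0.

Lemma uscaleA a b v : uscale a (uscale b v) = uscale (a * b) v.
Proof.
by case: (upi_surj v) => t ->; rewrite !uE; exact/upiP/ucong_scaleA.
Qed.
Lemma uscale1 : left_id 1 uscale.
Proof.
by move=> a; case: (upi_surj a) => t ->; rewrite !uE; exact/upiP/ucong_scale1.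
Qed.
Lemma uscaleDr : right_distributive uscale +%R.
Proof.
move=> c a b; case: (upi_surj a) (upi_surj b) => t -> [u ->].
rewrite /GRing.add/= !uE; exact/upiP/ucong_scaleDr.
Qed.
Lemma uscaleDl v : {morph uscale^~ v : a b / a + b}.
Proof.
move=> a b; case: (upi_surj v) => t ->.
rewrite [RHS]/GRing.add/= !uE; exact/upiP/ucong_scaleDl.
Qed.
HB.instance Definition _ := GRing.Zmodule_isLmodule.Build F uenv
  uscaleA uscale1 uscaleDr uscaleDl.

Lemma uscaleAl (a : F) (x y : uenv) : a *: (x * y) = (a *: x) * y.
Proof.
case: (upi_surj x) (upi_surj y) => t -> [u ->].
rewrite /GRing.mul /GRing.scale/= !uE; exact/upiP/ucong_scaleAl.
Qed.
HB.instance Definition _ := GRing.Lmodule_isLalgebra.Build F uenv uscaleAl.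
Lemma uscaleAr (a : F) (x y : uenv) : a *: (x * y) = x * (a *: y).
Proof.
case: (upi_surj x) (upi_surj y) => t -> [u ->].
rewrite /GRing.mul /GRing.scale/= !uE; exact/upiP/ucong_scaleAr.
Qed.
HB.instance Definition _ := GRing.Lalgebra_isAlgebra.Build F uenv uscaleAr.

Lemma upiD t u : upi (UAdd t u) = upi t + upi u. Proof. by rewrite -uaddE. Qed.
Lemma upiN t : upi (UOpp t) = - upi t. Proof. by rewrite -uoppE. Qed.
Lemma upiM t u : upi (UMul t u) = upi t * upi u. Proof. by rewrite -umulE. Qed.
Lemma upiZ a t : upi (UScale a t) = a *: upi t. Proof. by rewrite -uscaleE. Qed.

Definition uiota (x : L) : uenv := upi (UGen x).

Lemma uiota_linear : linear uiota.
Proof.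
move=> a x y; rewrite /uiota -upiZ -upiD; apply/upiP.
apply: ucong_trans (ucong_genD _ _) _.
by apply: ucong_add (ucong_refl _); exact: ucong_genZ.
Qed.
HB.instance Definition _ :=
  GRing.isLinear.Build F L uenv *:%R uiota uiota_linear.

Lemma uiota_rep : restricted_rep uiota.
Proof.
split=> [x y|x].
  by rewrite /uiota -!upiM -upiN -upiD; apply/upiP/ucong_lie.
have -> : uiota (ppow x) = upi (iter p (UMul (UGen x)) UOne).
  by apply/upiP/ucong_ppow.
by elim: p => [|n IHn] //=; rewrite upiM IHn exprS.
Qed.

Section Lift.
Variables (A : algType F) (f : {linear L -> A}).
Hypothesis frep : restricted_rep f.

Definition ulift (a : uenv) : A := ueval f (repr a).

Lemma uliftE t : ulift (upi t) = ueval f t.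
Proof. by apply: ueval_cong (repr_upi t) => //; exact: linearP. Qed.

Lemma ulift_linear : linear ulift.
Proof.
move=> c a b; case: (upi_surj a) (upi_surj b) => t -> [u ->].
by rewrite -upiZ -upiD !uliftE.
Qed.
Lemma ulift_monoid : monoid_morphism ulift.
Proof.
split=> [|a b]; first exact: uliftE.
case: (upi_surj a) (upi_surj b) => t -> [u ->].
by rewrite -upiM !uliftE.
Qed.
Definition ulift_lrmorphism : {lrmorphism uenv -> A} :=
  HB.pack ulift (GRing.isLinear.Build F uenv A *:%R ulift ulift_linear)
    (GRing.isMonoidMorphism.Build uenv A ulift ulift_monoid).

Lemma ulift_uniq (h : {lrmorphism uenv -> A}) :
  (forall x, h (uiota x) = f x) -> h =1 ulift.
Proof.
move=> hf a; case: (upi_surj a) => t ->; rewrite uliftE.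
elim: t => [x|||t IH|t IHt u IHu|t IHt u IHu|c t IH] /=.
- exact: hf.
- exact: (rmorph0 h).
- exact: (rmorph1 h).
- by rewrite upiN -IH; exact: (rmorphN h).
- by rewrite upiD -IHt -IHu; exact: (rmorphD h).
- by rewrite upiM -IHt -IHu; exact: (rmorphM h).
- by rewrite upiZ -IH; exact: (linearZZ h).
Qed.

End Lift.

Lemma restricted_enveloping_exists_gt0 :
  exists (U : algType F) (iota : {linear L -> U}), restricted_enveloping iota.
Proof.
exists uenv, uiota; split=> [|A f frep]; first exact: uiota_rep.
exists (ulift_lrmorphism frep); split=> [x|h]; first exact: uliftE.
exact: (ulift_uniq frep).
Qed.

End RestrictedEnvelopingExists.

Theorem restricted_enveloping_exists (F : fieldType) (p : nat)
    (L : restrictedLieType F p) : p \in [pchar F] ->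
  exists (U : algType F) (iota : {linear L -> U}), restricted_enveloping iota.
Proof.
move=> /andP[/prime_gt0 p_gt0 _]; exact: restricted_enveloping_exists_gt0.
Qed.

(* Main.v *)
From HB Require Import structures.
Require Import Defs.
From mathcomp Require Import all_boot all_order all_algebra.
From mathcomp Require Import generic_quotient.
From mathcomp Require Import boolp classical_sets cardinality.

(** The only input from Lie theory is that U is generated by elements s killed
by a nonzero p-polynomial. Let B be the quotient of U by its largest locally
nilpotent ideal: units lift, so B is again a GI-algebra, and B is semiprime.

Let s be a root of f and X a tangent vector at 1 to a curve of units that is
rational in r (any algebraic X, via 1 + r X). Apply the group identity to the
conjugates of t - s by such curves. Modulo f(t), the lowest coefficient in r
shows that a product of factors a(t) X (t - s) X vanishes, where
a(t) = f(t) / (t - s). If bc = 0, the case s = cyb, f = t^2 makes the right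
ideal bXcB nil of bounded index, so bXc = 0; hence bc = 0 implies bBc = 0, and B
is reduced. If B is reduced and f separable, one gets Psi(X [X, s]) = 0, where
Psi / f'(s) is the projection of B onto the centralizer of s. Polarizing, the
commutators [s, X] lie in a space N that is closed under products and meets
the centralizer of s trivially. For x in N, f(s + r x) commutes with s + r x and
has its coefficients in N, so it is zero; its top coefficient shows that x is
nilpotent, hence x = 0 and s is central. Over a perfect field every generator
is separable in the reduced algebra B, so B is commutative.

Thus the commutators of U lie in a locally nilpotent ideal, and since the
generators are algebraic, U is locally finite. *)

Set Implicit Arguments.
Unset Strict Implicit.
Unset Printing Implicit Defensive.

Import GRing.Theory.
Local Open Scope ring_scope.

(** * Tangent directions to the group of units *)

Definition ad (R : nzRingType) (x y : R) := x * y - y * x.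

Definition map_alg (F : fieldType) (A : algType F) (p : {poly F}) : {poly A} :=
  map_poly (GRing.in_alg A) p.

(** Stated with finite lists, since each use asks for a point outside a finite list of bad
    values. *)
Definition infinite_field (F : fieldType) :=
  forall s : seq F, exists x, x \notin s.

Section CentralEvaluation.
Variables (F : fieldType) (R : nzRingType) (c : {rmorphism F -> R}).
Hypothesis c_central : forall k x, c k * x = x * c k.

Lemma horner_central (p q : {poly R}) k :
  (p * q).[c k] = p.[c k] * q.[c k].
Proof. by rewrite hornerM_comm //; rewrite /comm_poly c_central. Qed.

(** A Vandermonde argument by divided differences. For a good k0, the quotient q of p - p(k0) by X -
    k0 takes the values (p(k) - p(k0)) / (k - k0) in S at the good k other than k0; so k0 joins the
    bad list, and the coefficients of p come back from those of q. *)
Lemma poly_coef_in (S : R -> Prop) (bad : seq F) (p : {poly R}) :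
  infinite_field F -> S 0 -> (forall x y, S x -> S y -> S (x + y)) ->
  (forall k x, S x -> S (c k * x)) ->
  (forall k, k \notin bad -> S p.[c k]) -> forall i, S p`_i.
Proof.
move=> Finf S0 SD SZ; have [n] := ubnP (size p).
elim: n p bad => // n IHn p bad; rewrite ltnS => le_p_n Sp i.
have SN x : S x -> S (- x).
  by move=> Sx; have := SZ (-1) x Sx; rewrite rmorphN1 mulN1r.
have [k0 k0P] := Finf bad; have Sp0 := Sp _ k0P.
have /factor_theorem[q def_p] : root (p - p.[c k0]%:P) (c k0).
  by rewrite /root !hornerE subrr.
have [q0|q_neq0] := eqVneq q 0.
  have -> : p = p.[c k0]%:P by apply/eqP; rewrite -subr_eq0 def_p q0 mul0r.
  by rewrite coefC; case: ifP.
have Sq j : S q`_j.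
  apply: (IHn q (k0 :: bad)) => [|k].
    apply: leq_trans le_p_n.
    have <- : size (p - p.[c k0]%:P) = (size q).+1.
      by rewrite def_p size_Mmonic ?monicXsubC // size_XsubC addn2.
    case: (leqP (size p) 1) => [/size1_polyC ->|lt1p].
      by rewrite hornerC subrr size_poly0.
    by rewrite size_polyDl // size_polyN (leq_ltn_trans (size_polyC_leq1 _)).
  rewrite inE negb_or => /andP[k_neq0 /Sp Spk].
  have dk : k - k0 != 0 by rewrite subr_eq0.
  have : S (c (k - k0)^-1 * (p.[c k] - p.[c k0])) by apply/SZ/SD/SN.
  have -> : p.[c k] - p.[c k0] = c (k - k0) * q.[c k].
    have := congr1 (horner^~ (c k)) def_p.
    by rewrite hornerD hornerN hornerC horner_central hornerXsubC -rmorphB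
               c_central.
  by rewrite mulrA -rmorphM mulVf // rmorph1 mul1r.
have -> : p = q * ('X - (c k0)%:P) + p.[c k0]%:P by rewrite -def_p subrK.
rewrite coefD coefC mulrBr coefB coefMX coefMC.
apply: (SD); last by case: ifP.
apply: (SD); first by case: ifP.
by rewrite -c_central; apply/SN/SZ.
Qed.

End CentralEvaluation.

Lemma in_alg_central (F : fieldType) (A : algType F) k (x : A) :
  GRing.in_alg A k * x = x * GRing.in_alg A k.
Proof. by rewrite /GRing.in_alg /= -!scalerAl -scalerAr mul1r mulr1. Qed.

Lemma map_alg_central (F : fieldType) (A : algType F) (f : {poly F})
    (p : {poly A}) : map_alg A f * p = p * map_alg A f.
Proof.
apply/polyP => i; rewrite coefMr coefM; apply: eq_bigr => j _.
by rewrite coef_map /= in_alg_central.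
Qed.

Section Tangent.
Variables (F : fieldType) (B : algType F).
Hypothesis Finf : infinite_field F.
Local Notation "p ^~" := (map_alg B p) (at level 2, format "p ^~").

(* [tangent X]: X is the velocity at r = 0 of a curve [u r = 1 + r X + ...] in
   the group of units whose inverse [v r / q r] is a rational function. *)
Definition tangent (X : B) := exists (u v : {poly B}) (q : {poly F}),
  [/\ u * v = q^~, v * u = q^~, u`_0 = 1, q`_0 = 1 & u`_1 = X].

Lemma coef_map_alg (q : {poly F}) i : (q^~)`_i = (q`_i)%:A.
Proof. by rewrite coef_map. Qed.

Lemma coefM1 (R : nzRingType) (p q : {poly R}) :
  (p * q)`_1 = p`_0 * q`_1 + p`_1 * q`_0.
Proof. by rewrite coefM big_ord_recl big_ord1. Qed.

Lemma curve_inv0 (u v : {poly B}) (q : {poly F}) :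
  u * v = q^~ -> u`_0 = 1 -> q`_0 = 1 -> v`_0 = 1.
Proof.
move=> /(congr1 (fun p : {poly B} => p`_0)) + u0 q0.
by rewrite coef0M coef_map_alg u0 q0 mul1r scale1r.
Qed.

Lemma curve_inv1 (u v : {poly B}) (q : {poly F}) :
  u * v = q^~ -> u`_0 = 1 -> q`_0 = 1 -> v`_1 = (q`_1)%:A - u`_1.
Proof.
move=> uv u0 q0; have v0 := curve_inv0 uv u0 q0.
have /(congr1 (fun p : {poly B} => p`_1)) := uv.
by rewrite coefM1 coef_map_alg u0 v0 mul1r mulr1 => <-; rewrite addrK.
Qed.

(** Velocities at 1 add when curves are multiplied. *)
Lemma tangentD X Y : tangent X -> tangent Y -> tangent (X + Y).
Proof.
move=> [u [v [q [uv vu u0 q0 <-]]]] [u' [v' [q' [uv' vu' u0' q0' <-]]]].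
exists (u * u'), (v' * v), (q * q'); split.
- by rewrite mulrA -(mulrA u) uv' -map_alg_central -mulrA uv /map_alg
             (mulrC q) rmorphM.
- by rewrite mulrA -(mulrA v') vu -map_alg_central -mulrA vu' /map_alg rmorphM.
- by rewrite coef0M u0 u0' mulr1.
- by rewrite coef0M q0 q0' mulr1.
- by rewrite coefM1 u0 u0' mul1r mulr1 addrC.
Qed.

(** This is p(k r); rescaling the parameter of a curve multiplies its velocity by k. *)
Definition dilate (R : lalgType F) (k : F) (p : {poly R}) : {poly R} :=
  \poly_(i < size p) (k ^+ i *: p`_i).

Lemma coef_dilate (R : lalgType F) k (p : {poly R}) i :
  (dilate k p)`_i = k ^+ i *: p`_i.
Proof.
by rewrite coef_poly; case: ltnP => // ?; rewrite nth_default // scaler0.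
Qed.

Lemma dilateM (R : algType F) k (p q : {poly R}) :
  dilate k (p * q) = dilate k p * dilate k q.
Proof.
apply/polyP => i; rewrite coef_dilate !coefM scaler_sumr.
apply: eq_bigr => j _; rewrite !coef_dilate -scalerAl -scalerAr scalerA -exprD.
by rewrite subnKC // -ltnS.
Qed.

Lemma tangentZ k X : tangent X -> tangent (k *: X).
Proof.
move=> [u [v [q [uv vu u0 q0 <-]]]].
pose qk : {poly F} := dilate k (q : {poly F^o}).
have coef_qk i : qk`_i = k ^+ i * q`_i by exact: (@coef_dilate F^o).
have qE : dilate k q^~ = qk^~.
  by apply/polyP => i; rewrite coef_dilate !coef_map_alg coef_qk scalerA.
exists (dilate k u), (dilate k v), qk; split.
- by rewrite -qE -uv dilateM.
- by rewrite -qE -vu dilateM.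
- by rewrite coef_dilate expr0 scale1r.
- by rewrite coef_qk expr0 mul1r.
- by rewrite coef_dilate expr1.
Qed.

Lemma tangent0 : tangent 0.
Proof.
exists 1, 1, 1; rewrite /map_alg rmorph1 mulr1; split=> //;
by rewrite coef1.
Qed.

Lemma tangentN X : tangent X -> tangent (- X).
Proof. by move=> /(tangentZ (-1)); rewrite scaleN1r. Qed.

Lemma tangentB X Y : tangent X -> tangent Y -> tangent (X - Y).
Proof. by move=> tX /tangentN; exact: tangentD. Qed.

Lemma tangent_conj g h X : g * h = 1 -> h * g = 1 ->
  tangent X -> tangent (g * X * h).
Proof.
move=> gh hg [u [v [q [uv vu u0 q0 <-]]]].
have ghP : g%:P * h%:P = 1 :> {poly B} by rewrite -polyCM gh.
have hgP : h%:P * g%:P = 1 :> {poly B} by rewrite -polyCM hg.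
exists (g%:P * u * h%:P), (g%:P * v * h%:P), q; split.
- rewrite !mulrA -(mulrA _ h%:P) hgP mulr1 -(mulrA _ u) uv -map_alg_central.
  by rewrite -mulrA ghP mulr1.
- rewrite !mulrA -(mulrA _ h%:P) hgP mulr1 -(mulrA _ v) vu -map_alg_central.
  by rewrite -mulrA ghP mulr1.
- by rewrite coefMC coefCM u0 mulr1.
- by [].
- by rewrite coefMC coefCM.
Qed.

Lemma horner_alg_poly (q : {poly F}) k :
  (q^~).[GRing.in_alg B k] = GRing.in_alg B q.[k].
Proof. exact: horner_map. Qed.

Lemma horner_algM (p q : {poly B}) k :
  (p * q).[GRing.in_alg B k] = p.[GRing.in_alg B k] * q.[GRing.in_alg B k].
Proof. exact/horner_central/in_alg_central. Qed.

(** The size of q bounds the length of a duplicate-free list of roots, so a longest one exists and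
    contains every root. *)
Lemma not_rootP (q : {poly F}) : q != 0 ->
  exists bad : seq F, forall k, k \notin bad -> q.[k] != 0.
Proof.
move=> q_neq0; pose P n := exists2 s : seq F, uniq s & size s = n /\ all (root
  q) s.
have [n Pn maxn] : exists2 n, P n & ~ P n.+1.
  apply: contrapT => noP; have {}noP n : P n.
    elim: n => [|n IHn]; first by exists [::].
    by apply: contrapT => nP; apply: noP; exists n.
  have [s us [ss rs]] := noP (size q).
  by have := max_poly_roots q_neq0 rs us; rewrite ss ltnn.
have [s us [ss rs]] := Pn; exists s => k ks; apply: contra_notN maxn => rk.
by exists (k :: s); rewrite /= ?ks ?us ?ss //= /root rk.
Qed.

(* The conjugates u(r) Y u(r)^-1 are tangent for almost all r in F, hence so are
   the coefficients in r. *)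
Lemma curve_conj_coef (u v : {poly B}) (q : {poly F}) Y i :
  u * v = q^~ -> v * u = q^~ -> q`_0 = 1 -> tangent Y ->
  tangent (u * Y%:P * v)`_i.
Proof.
move=> uv vu q0 tY.
have /not_rootP[bad badP] : q != 0.
  by apply: contra_eq_neq q0 => ->; rewrite coef0 eq_sym oner_eq0.
apply: (@poly_coef_in _ _ (GRing.in_alg B) _ tangent bad) => //.
- exact: in_alg_central.
- exact: tangent0.
- exact: tangentD.
- by move=> k x /(tangentZ k); rewrite /GRing.in_alg /= -scalerAl mul1r.
move=> k /badP qk; rewrite !horner_algM hornerC.
set U := u.[_]; set V := v.[_].
have UV : U * V = (q.[k])%:A by rewrite -horner_algM uv horner_alg_poly.
have VU : V * U = (q.[k])%:A by rewrite -horner_algM vu horner_alg_poly.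
have -> : U * Y * V = q.[k] *: (U * Y * (q.[k]^-1 *: V)).
  by rewrite -scalerAr scalerA mulfV // scale1r.
apply/tangentZ/tangent_conj => //.
  by rewrite -scalerAr UV scalerA mulVf // scale1r.
by rewrite -scalerAl VU scalerA mulVf // scale1r.
Qed.

(** The linear coefficient of u Y v is [X, Y] + q_1 Y, and q_1 Y is tangent. *)
Lemma tangent_ad X Y : tangent X -> tangent Y -> tangent (ad X Y).
Proof.
move=> [u [v [q [uv vu u0 q0 <-]]]] tY.
have := curve_conj_coef 1 uv vu q0 tY.
rewrite coefM1 !coefMC u0 (curve_inv0 uv u0 q0) (curve_inv1 uv u0 q0).
rewrite mul1r mulr1 mulrBr -scalerAr mulr1 => /tangentD.
move=> /(_ _ (tangentN (tangentZ q`_1 tY))).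
by rewrite addrAC [_ *: _ - _]addrC addrK addrC.
Qed.

End Tangent.

Section Algebraic.
Variables (F : fieldType) (B : algType F).
Hypothesis Finf : infinite_field F.
Local Notation "p ^~" := (map_alg B p) (at level 2, format "p ^~").

(* If f(x) = 0 with f monic of degree d, then 1 + r x divides
   q(r) = (-r)^d f(-1/r). *)
Lemma algebraic_curve (x : B) (f : {poly F}) : f != 0 -> (f^~).[x] = 0 ->
  exists (v : {poly B}) (q : {poly F}),
    [/\ (1 + x%:P * 'X) * v = q^~, v * (1 + x%:P * 'X) = q^~ & q`_0 = 1].
Proof.
move=> f_neq0 fx; pose d := (size f).-1; pose P := (lead_coef f)^-1 *: f.
have lead_neq0 : lead_coef f != 0 by rewrite lead_coef_eq0.
have Px : \sum_(i < d.+1) P`_i *: x ^+ i = 0.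
  transitivity ((lead_coef f)^-1 *: (f^~).[x]); last by rewrite fx scaler0.
  rewrite (@horner_coef_wide _ d.+1); last first.
    by rewrite size_map_poly prednK // size_poly_gt0.
  rewrite scaler_sumr; apply: eq_bigr => i _.
  by rewrite coef_map_alg coefZ -scalerAl mul1r scalerA.
pose q := \poly_(i < d.+1) ((-1) ^+ i * P`_(d - i)).
(* The power series coefficients of q(r) / (1 + r x). The one in degree d is a scalar multiple of
   f(x) = 0, so the series stops there. *)
pose w := fix w j := if j is j'.+1 then (q`_j)%:A - x * w j' else (q`_0)%:A.
have wcx j : GRing.comm x (w j).
  elim: j => [|j IHj] /=; first exact: in_alg_comm.
  apply: commrB; first exact: in_alg_comm.
  exact: commrM.
have wE j : (j <= d)%N ->
    w j = (-1) ^+ j *: \sum_(i < j.+1) P`_(d - i) *: x ^+ (j - i).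
  elim: j => [|j IHj] lejd;
    first by rewrite /= big_ord1 coef_poly !expr0 mul1r scale1r.
  rewrite big_ord_recr /= (IHj (ltnW lejd)) coef_poly ltnS lejd subnn expr0.
  rewrite scalerDr scalerA addrC; congr (_ + _).
  rewrite -scalerAr -scaleNr exprS mulN1r mulr_sumr; congr (_ *: _).
  by apply: eq_bigr => i _; rewrite subSn -1?ltnS // exprS scalerAr.
have wd j : (d <= j)%N -> w j = 0.
  move=> /subnK <-; elim: (j - d)%N => [|k IHk] /=.
    rewrite wE // (reindex_inj rev_ord_inj) /=.
    rewrite (eq_bigr (fun i : 'I_d.+1 => P`_i *: x ^+ i)) ?Px ?scaler0 // => i
      _.
    by rewrite subSS subKn // -ltnS.
  by rewrite IHk mulr0 subr0 coef_poly ltnNge ltnS leq_addl /= scale0r.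
have coef_v j : (\poly_(i < d) w i)`_j = w j.
  by rewrite coef_poly; case: ltnP => // /wd ->.
exists (\poly_(i < d) w i), q; split.
- apply/polyP => -[|j]; rewrite mulrDl mul1r coefD -mulrA -commr_polyX mulrA.
    by rewrite coefMX coef_v addr0 coef_map_alg.
  by rewrite coefMX /= coefCM !coef_v coef_map_alg /= subrK.
- apply/polyP => -[|j]; rewrite mulrDr mulr1 coefD mulrA.
    by rewrite coefMX coef_v addr0 coef_map_alg.
  by rewrite coefMX /= coefMC !coef_v coef_map_alg /= -(wcx j) subrK.
- rewrite coef_poly /= expr0 mul1r subn0 coefZ /lead_coef -/d mulVf //.
Qed.

Lemma algebraic_tangent x (f : {poly F}) :
  f != 0 -> (f^~).[x] = 0 -> tangent x.
Proof.
move=> f_neq0 /(algebraic_curve f_neq0)[v [q [uv vu q0]]].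
exists (1 + x%:P * 'X), v, q; split=> //.
  by rewrite coefD coefMX coef1 addr0.
by rewrite coefD coefMX coef1 coefC add0r.
Qed.

(** With u = 1 + r x, coefficient j + 1 of u Y v is q_(j+1) Y + [x, Y] v_j, so [x, Y] v_j is
    tangent. The recursion x v_j = q_(j+1) - v_(j+1) then absorbs the powers of x one by one. *)
Lemma ad_powers_tangent x (f : {poly F}) Y i :
  f != 0 -> (f^~).[x] = 0 -> tangent Y -> tangent (ad x Y * x ^+ i).
Proof.
move=> f_neq0 /(algebraic_curve f_neq0)[v [q [uv vu q0]]] tY.
have v0 : v`_0 = 1.
  apply: curve_inv0 uv _ q0.
  by rewrite coefD coefMX coef1 addr0.
have vS j : v`_j.+1 = (q`_j.+1)%:A - x * v`_j.
  rewrite -coef_map_alg -uv mulrDl mul1r coefD -mulrA -commr_polyX mulrA coefMX.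
  by rewrite /= coefCM addrK.
suff: forall i j, tangent (ad x Y * x ^+ i * v`_j).
  by move=> /(_ i 0%N); rewrite v0 mulr1.
elim=> [|{}i IHi] j; last first.
  have := tangentB (tangentZ q`_j.+1 (IHi 0%N)) (IHi j.+1).
  rewrite v0 mulr1 vS mulrBr -scalerAr mulr1 opprB addrC subrK.
  by rewrite exprSr !mulrA.
rewrite expr0 mulr1.
have := curve_conj_coef Finf j.+1 uv vu q0 tY.
rewrite -mulrA mulrDl mul1r coefD coefCM -[x%:P * _ * _]mulrA -commr_polyX.
rewrite !mulrA coefMX /= -!mulrA !coefCM vS mulrBr -scalerAr mulr1.
move=> /tangentB/(_ (tangentZ q`_j.+1 tY)).
by rewrite addrC -!addrA addKr addrC /ad mulrBl -!mulrA.
Qed.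

End Algebraic.

(** * The group identity along conjugates of a root *)

Section AlternatingProducts.
Variables (R : nzRingType) (T : Type).

Fixpoint altprod (A A' : T -> R) (c : bool) (l : seq T) : R :=
  if l is k :: l' then (if c then A k else A' k) * altprod A A' (~~ c) l'
  else 1.

End AlternatingProducts.

(* Substituting x_i := A_(i,0)^-1 A_(i,1) turns a reduced word into an
   alternating product A_k1^-1 A_k2 A_k3^-1 ... with consecutive distinct
   indices. *)
Lemma GI_altprod (F : fieldType) (B : algType F) : GI_algebra B ->
  exists n (k : 'I_n * bool) l, path (fun a b => a != b) k l /\
    forall A A' : 'I_n * bool -> B,
      (forall j, A j * A' j = 1 /\ A' j * A j = 1) ->
      altprod A A' false (k :: l) = 1.
Proof.
case=> n [[|a w] [// _ red_w GI]].
pose inv (b : 'I_n * bool) := (b.1, ~~ b.2).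
have inv_neq b : b != inv b.
  by apply/eqP => /(congr1 snd) /=; case: b.2.
(* The letter b becomes A_b^-1 A_(inv b). Across two letters a and b, the neighbours inv a and b
   coincide only if b is the inverse of a, which reducedness excludes. *)
pose flat (v : seq ('I_n * bool)) := flatten [seq [:: b; inv b] | b <- v].
exists n, a, (inv a :: flat w); split.
  rewrite /= inv_neq /=; move: red_w => /=.
  elim: w a {GI} => //= b w IHw a /andP[ab /IHw pw]; rewrite inv_neq pw !andbT.
  apply: contra ab => /eqP <- /=; rewrite eqxx /=.
  by case: a.2.
move=> A A' AA'.
have := GI (fun i => A' (i, false) * A (i, true))
           (fun i => A' (i, true) * A (i, false)).
rewrite /word_eval => <-; last first.
  move=> i; split.
    rewrite -mulrA (mulrA (A _)) (AA' _).1 mul1r; exact: (AA' _).2.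
  rewrite -mulrA (mulrA (A _)) (AA' _).1 mul1r; exact: (AA' _).2.
rewrite -[a :: _]/(flat (a :: w)); elim: (a :: w) => [|b v IHv].
  by rewrite big_nil.
rewrite big_cons -IHv /= mulrA; congr (_ * _).
by case: b => i [].
Qed.

Lemma injection_in_field (F : fieldType) (T : finType) : infinite_field F ->
  exists th : T -> F, injective th.
Proof.
move=> Finf.
have [s [us ss]] : exists s : seq F, uniq s /\ size s = #|T|.
  elim: #|T| => [|m [s [us ss]]]; first by exists [::].
  by have [x xs] := Finf s; exists (x :: s); rewrite /= xs us ss.
exists (fun x => nth 0 s (enum_rank x)) => x y /eqP.
by rewrite nth_uniq ?ss ?ltn_ord // => /eqP/val_inj/enum_rank_inj.
Qed.

Section CurveIdentity.
Variables (F : fieldType) (B : algType F).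
Hypothesis Finf : infinite_field F.
Local Notation "p ^~" := (map_alg B p) (at level 2, format "p ^~").

Definition multiple (f : {poly F}) (p : {poly B}) := exists C, p = C * f^~.

Lemma multiple0 f : multiple f 0.
Proof. by exists 0; rewrite mul0r. Qed.

Lemma multipleD f p q : multiple f p -> multiple f q -> multiple f (p + q).
Proof. by move=> [C ->] [D ->]; exists (C + D); rewrite mulrDl. Qed.

Lemma multipleMl f p q : multiple f q -> multiple f (p * q).
Proof. by move=> [C ->]; exists (p * C); rewrite mulrA. Qed.

Lemma multipleMr f p q : multiple f p -> multiple f (p * q).
Proof.
by move=> [C ->]; exists (C * q); rewrite -!mulrA map_alg_central.
Qed.

Lemma multipleN f p : multiple f p -> multiple f (- p).
Proof. by move=> [C ->]; exists (- C); rewrite mulNr. Qed.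

Lemma multipleB f p q : multiple f p -> multiple f q -> multiple f (p - q).
Proof. by move=> ? /multipleN; exact: multipleD. Qed.

Lemma multiple_sum f (I : Type) (r : seq I) (P : pred I) (E : I -> {poly B}) :
  (forall i, P i -> multiple f (E i)) -> multiple f (\sum_(i <- r | P i) E i).
Proof.
move=> fE; apply: (big_ind (multiple f)) => //; first exact: multiple0.
exact: multipleD.
Qed.

(** What an alternating word leaves in lowest order: every junction between the curves of two
    consecutive letters contributes a factor X. *)
Fixpoint altcore (a b X : {poly B}) (c : bool) (n : nat) : {poly B} :=
  if n is n'.+1 then X * (if c then b else a) * altcore a b X (~~ c) n' else 1.

Section Word.
Variables (T : finType) (u v : T -> {poly B}) (q : T -> {poly F}) (th : T -> F).
Variables (X : B) (a b : {poly B}) (f : {poly F}).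
Hypothesis th_inj : injective th.
Hypothesis uv : forall k, u k * v k = (q k)^~.
Hypothesis vu : forall k, v k * u k = (q k)^~.
Hypothesis u0 : forall k, (u k)`_0 = 1.
Hypothesis q0 : forall k, (q k)`_0 = 1.
Hypothesis u1 : forall k, (u k)`_1 = th k *: X.
Hypothesis ab : a * b = f^~.
Hypothesis ba : b * a = f^~.

Local Notation core c := (if c then b else a).

(* Polynomials in the curve parameter r over polynomials in t. *)
Let lift (p : {poly B}) : {poly {poly B}} := map_poly polyC p.

Let curveword (c : bool) (l : seq T) : {poly {poly B}} :=
  altprod (fun k => lift (u k) * b%:P * lift (v k))
          (fun k => lift (u k) * a%:P * lift (v k)) c l.

Let core_core c : core c * core (~~ c) = f^~.
Proof. by case: c. Qed.

(** Induction along the word, G being the part already read. At a junction, v_k u_k' = 1 + r (q_1 +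
    (th k' - th k) X) + ..., and in its scalar terms [core c] meets [core (~~ c)], with product f.
    So modulo f each junction raises the order in r by one and leaves (th k' - th k) X, where the
    scalar is nonzero because consecutive indices differ. *)
Lemma curveword_coef l k c m (G : {poly {poly B}}) :
  path (fun i j => i != j) k l ->
  (forall i, (i < m)%N -> multiple f (G`_i * core c)) ->
  exists2 kap : F, kap != 0 &
    multiple f ((G * (core c)%:P * lift (v k) * curveword (~~ c) l)`_(m + size
      l)
      - kap%:A%:P * (G`_m * core c * altcore a b X%:P (~~ c) (size l))).
Proof.
have low (H : {poly {poly B}}) m' (J : {poly {poly B}}) :
    (forall i, (i < m')%N -> multiple f H`_i) ->
    multiple f ((H * J)`_m' - H`_m' * J`_0).
  move=> Hlow; rewrite coefM big_ord_recr /= subnn addrK.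
  by apply: multiple_sum => i _; apply/multipleMr/Hlow.
elim: l k c m G => [|k' l IHl] k c m G /=.
  move=> _ Glow; exists 1; first exact: oner_neq0.
  rewrite scale1r mul1r !mulr1 addn0.
  have := low (G * (core c)%:P) m (lift (v k)).
  rewrite coef_map /= (curve_inv0 (uv k)) // coefMC mulr1; apply => i lt_im.
  by rewrite coefMC; exact: Glow.
move=> /andP[kk' path_l] Glow.
pose J := lift (v k) * lift (u k'); pose H := G * (core c)%:P.
have Hlow i : (i < m)%N -> multiple f H`_i by rewrite coefMC; exact: Glow.
have J0 : J`_0 = 1.
  by rewrite coef0M !coef_map /= (curve_inv0 (uv k)) // u0 mulr1.
have J1 : J`_1 = ((q k)`_1)%:A%:P + (th k' - th k)%:A%:P * X%:P.
  rewrite coefM1 !coef_map /= (curve_inv0 (uv k)) // u0 mul1r mulr1.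
  rewrite (curve_inv1 (uv k)) // !u1 -polyCM -polyCD addrC -polyCD.
  by rewrite -scalerAl mul1r scalerBl addrA addrAC.
have HJlow i : (i < m.+1)%N -> multiple f ((H * J)`_i * core (~~ c)).
  rewrite ltnS => le_im; rewrite coefM mulr_suml; apply: multiple_sum => j _.
  have [lt_jm|le_mj] := ltnP j m.
    by apply/multipleMr/multipleMr/Hlow.
  have -> : (i - j)%N = 0%N by apply/eqP; rewrite subn_eq0 (leq_trans le_im).
  rewrite J0 mulr1 coefMC -mulrA core_core; apply: multipleMl.
  by exists 1; rewrite mul1r.
have [kap kap_neq0] := IHl k' (~~ c) m.+1 (H * J) path_l HJlow.
rewrite negbK => IH; exists (kap * (th k' - th k)).
  by rewrite mulf_neq0 // subr_eq0 (inj_eq th_inj) eq_sym.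
have -> : H * lift (v k) * curveword (~~ c) (k' :: l)
   = H * J * (core (~~ c))%:P * lift (v k') * curveword c l.
  rewrite /curveword /= negbK /J; set U := lift (u k'); set V := lift (v k').
  by case: (c); rewrite /= !mulrA.
rewrite -/H addnS -addSn; set W := curveword c l in IH *.
set alt := altcore _ _ _ _ _ in IH *.
rewrite -(subrKA (kap%:A%:P * ((H * J)`_m.+1 * core (~~ c) * alt))).
apply: multipleD IH _.
suff HJ : multiple f ((H * J)`_m.+1 * core (~~ c)
    - (th k' - th k)%:A%:P * (H`_m * X%:P * core (~~ c))).
  have -> : (kap * (th k' - th k))%:A%:P = kap%:A%:P * (th k' - th k)%:A%:P
     :> {poly B} by rewrite -polyCM -scalerAl mul1r scalerA.
  rewrite -[X in _ - X]mulrA -mulrBr; apply: multipleMl.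
  have -> : (G`_m * core c) = H`_m by rewrite coefMC.
  rewrite !mulrA -mulrBl; apply: multipleMr.
  by rewrite !mulrA in HJ.
have HJE : multiple f ((H * J)`_m.+1 - (H`_m.+1 * J`_0 + H`_m * J`_1)).
  rewrite coefM big_ord_recr big_ord_recr /= subnn subSnn -addrA.
  rewrite [H`_m.+1 * _ + _]addrC addrK.
  by apply: multiple_sum => i _; apply/multipleMr/Hlow.
have HZ i : multiple f (H`_i * core (~~ c)).
  rewrite coefMC -mulrA core_core; apply: multipleMl.
  by exists 1; rewrite mul1r.
have := multipleD (multipleMr (core (~~ c)) HJE)
  (multipleD (HZ m.+1) (multipleMl ((q k)`_1)%:A%:P (HZ m))).
congr (multiple f _); rewrite J0 mulr1 J1 mulrDr.
have cent e (p : {poly B}) : p * e%:A%:P = e%:A%:P * p.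
  apply/polyP => i; rewrite coefMC coefCM; symmetry; exact: in_alg_central.
rewrite !cent !mulrA !cent !mulrBl !mulrDl -!mulrA.
rewrite -[LHS]addrA; congr (_ + _).
by rewrite [_ + (_ + _)]addrA opprD addrAC addNr add0r.
Qed.

(** The denominators cleared from the word: for A = u b v and A' = u a v one has A A' = q_k(r)^2
    f(t), so A' is this scalar times the inverse of A. *)
Fixpoint curve_scalar (c : bool) (l : seq T) (r : F) : {poly F} :=
  if l is k :: l'
  then (if c then 1 else ((q k).[r] ^+ 2)%:P * f) * curve_scalar (~~ c) l' r
  else 1.

(** For all but finitely many r and t the letters are units, and the group identity equates the word
    with [curve_scalar], which contains f because the first letter is an A'. As F is infinite, this
    extends to polynomials in t, and then, modulo f, to each coefficient in r; [curveword_coef]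
    evaluates the one in degree [size l]. *)
Lemma curve_identity k l : f != 0 -> path (fun i j => i != j) k l ->
  (forall A A' : T -> B, (forall j, A j * A' j = 1 /\ A' j * A j = 1) ->
     altprod A A' false (k :: l) = 1) ->
  multiple f (a * altcore a b X%:P true (size l)).
Proof.
move=> f_neq0 path_l GI.
have /not_rootP[badf badfP] := f_neq0.
have [bad badP] : exists bad : seq F,
    forall r, r \notin bad -> forall j, (q j).[r] != 0.
  suff [bad badP] : exists bad : seq F,
      forall r, r \notin bad -> forall j, j \in enum T -> (q j).[r] != 0.
    by exists bad => r rbad j; apply: badP => //; rewrite mem_enum.
  elim: (enum T) => [|j s [bad badP]]; first by exists [::].
  have /not_rootP[badj badjP] : q j != 0.
    by apply: contra_eq_neq (q0 j) => ->; rewrite coef0 eq_sym oner_eq0.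
  exists (badj ++ bad) => r; rewrite mem_cat negb_or => /andP[rj rb] i.
  by rewrite inE => /predU1P[->|]; [exact: badjP|exact: badP].
pose cF : {rmorphism F -> {poly B}} := polyC \o GRing.in_alg B.
have cF_central e (p : {poly B}) : cF e * p = p * cF e.
  by apply/polyP => i; rewrite coefMC coefCM; exact: in_alg_central.
have in_mult r : r \notin bad -> multiple f (curveword false (k :: l)).[cF r].
  move=> rbad; suff -> : (curveword false (k :: l)).[cF r]
      = (curve_scalar false (k :: l) r)^~.
    exists (((q k).[r] ^+ 2)%:P * curve_scalar true l r)^~.
    by rewrite -rmorphM /= mulrAC.
  apply/eqP; rewrite -subr_eq0; apply/eqP/polyP => i; rewrite coef0.
  move: i; apply: (@poly_coef_in _ _ (GRing.in_alg B) _ (fun x => x = 0) badf).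
  - exact: in_alg_central.
  - exact: Finf.
  - by [].
  - by move=> x y -> ->; rewrite addr0.
  - by move=> e x ->; rewrite mulr0.
  move=> t /badfP ft; apply/eqP; rewrite hornerD hornerN subr_eq0; apply/eqP.
  rewrite horner_alg_poly.
  pose ev (p : {poly {poly B}}) := p.[cF r].[GRing.in_alg B t].
  have evM p p' : ev (p * p') = ev p * ev p'.
    by rewrite /ev horner_central // horner_algM.
  have ev_lift p : ev (lift p) = p.[GRing.in_alg B r].
    by rewrite /ev horner_map /= hornerC.
  have evC p : ev p%:P = p.[GRing.in_alg B t] by rewrite /ev hornerC.
  pose A j := ev (lift (u j) * b%:P * lift (v j)).
  pose A' j := ev (lift (u j) * a%:P * lift (v j)).
  pose e j := (q j).[r] ^+ 2 * f.[t].
  have e_neq0 j : e j != 0 by rewrite mulf_neq0 // expf_neq0 // badP.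
  have core_e (p p' : {poly B}) j : p * p' = f^~ ->
      ev (lift (u j) * p%:P * lift (v j)) * ev (lift (u j) * p'%:P * lift (v j))
      = (e j)%:A.
    move=> pp'; rewrite !evM !ev_lift !evC.
    set U := (u j).[_]; set V := (v j).[_]; set P := p.[_]; set P' := p'.[_].
    have UV : U * V = ((q j).[r])%:A by rewrite -horner_algM uv horner_alg_poly.
    have VU : V * U = ((q j).[r])%:A by rewrite -horner_algM vu horner_alg_poly.
    have PP' : P * P' = (f.[t])%:A by rewrite -horner_algM pp' horner_alg_poly.
    rewrite !mulrA -(mulrA (U * P)) VU -scalerAr mulr1 -!scalerAl -(mulrA U)
      PP'.
    by rewrite -scalerAr mulr1 -scalerAl UV !scalerA /e expr2 mulrAC.
  have := GI A (fun j => (e j)^-1 *: A' j); set Ai := fun j => _ => GI1.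
  have rawE c s : ev (curveword c s) = (curve_scalar c s r).[t] *: altprod A Ai
    c s.
    elim: s c => [|j s IHs] c.
      by rewrite /= /curveword /= hornerC scale1r /ev !hornerC.
    rewrite /curveword /= evM [ev (altprod _ _ _ _)]IHs hornerM.
    case: c => /=; first by rewrite hornerC mul1r scalerAr.
    rewrite hornerM hornerC -/(e j) /Ai -scalerAl [RHS]scalerA.
    by rewrite mulrAC mulfV // mul1r scalerAr.
  rewrite -[LHS]/(ev _) rawE {}GI1 // => j; rewrite /Ai -scalerAr -scalerAl.
  by rewrite !core_e // scalerA mulVf // scale1r.
have coef_mult i : multiple f (curveword false (k :: l))`_i.
  apply: (@poly_coef_in _ _ cF cF_central (multiple f) bad) => //.
  - exact: multiple0.
  - exact: multipleD.
  - by move=> e x; exact: multipleMl.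
(* The part read at the start is the opening curve u_k, with constant term 1. *)
have [] := @curveword_coef l k false 0%N (lift (u k)) path_l; first by [].
move=> kap kap_neq0; rewrite add0n coef_map /= u0 !mul1r => /multipleB.
move=> /(_ _ (coef_mult (size l))).
rewrite /= addrAC subrr add0r => /multipleN; rewrite opprK.
move=> /(multipleMl (kap^-1)%:A%:P).
by rewrite mulrA -polyCM -scalerAl mul1r scalerA mulVf // scale1r mul1r.
Qed.


End Word.

(* Conjugating by curves tangent to distinct multiples of X, the alternating
   word is the lowest coefficient of the group identity, whose right-hand side
   is divisible by f(t). *)
Lemma GI_divisibility : GI_algebra B -> exists N,
  forall (X : B) (a b : {poly B}) (f : {poly F}), f != 0 -> tangent X ->
    a * b = f^~ -> b * a = f^~ -> multiple f (a * altcore a b X%:P true N).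
Proof.
move=> /GI_altprod[n [k [l [path_l GI]]]].
exists (size l) => X a b f f_neq0 tX ab ba.
have [th th_inj] := injection_in_field ('I_n * bool)%type Finf.
have /choice[c cP] : forall j, exists c : {poly B} * {poly B} * {poly F},
   [/\ c.1.1 * c.1.2 = c.2^~, c.1.2 * c.1.1 = c.2^~, c.1.1`_0 = 1, c.2`_0 = 1
      & c.1.1`_1 = th j *: X].
  move=> j; have [u [v [q tP]]] := tangentZ (th j) tX.
  by exists (u, v, q).
by apply: (@curve_identity _ (fun j => (c j).1.1) (fun j => (c j).1.2)
  (fun j => (c j).2) th) path_l GI => // j; case: (cP j).
Qed.

End CurveIdentity.

(** * Semiprime algebras are reduced *)

Definition semiprime_ring (R : nzRingType) :=
  forall x : R, (forall y, x * y * x = 0) -> x = 0.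

Definition reduced_ring (R : nzRingType) := forall x : R, x * x = 0 -> x = 0.

Lemma reduced_nilpotent (R : nzRingType) (x : R) n :
  reduced_ring R -> x ^+ n = 0 -> x = 0.
Proof.
move=> redR xn; have : x ^+ (2 ^ n) = 0.
  by rewrite -(subnK (ltnW (ltn_expl n (ltnSn 1)))) exprD xn mulr0.
elim: n {xn} => [|n IHn]; first by rewrite expr1.
by rewrite expnS mulnC exprM expr2 => /redR.
Qed.

Definition subalgebra_pred (F : fieldType) (A : algType F) (T : A -> Prop) :=
  [/\ T 1, forall x y, T x -> T y -> T (x + y),
      forall x y, T x -> T y -> T (x * y) & forall k x, T x -> T (k *: x)].

Definition generates (F : fieldType) (A : algType F) (G : A -> Prop) :=
  forall T : A -> Prop, subalgebra_pred T -> (forall x, G x -> T x) ->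
    forall x, T x.

Section Reduced.
Variables (F : fieldType) (B : algType F).
Hypothesis Finf : infinite_field F.
Local Notation "p ^~" := (map_alg B p) (at level 2, format "p ^~").

(* Linearizing (z y)^(N+1) z = 0 in y and multiplying by (z y)^N on the left
   leaves the single term ((z y)^N z) y' ((z y)^N z). *)
Lemma semiprime_bounded_nil (z : B) N : semiprime_ring B ->
  (forall y, (z * y) ^+ N * z = 0) -> z = 0.
Proof.
move=> spB; elim: N => [|N IHN] nilz; first by have := nilz 0; rewrite mul1r.
apply: IHN => y; apply: spB => y'.
(* [p] is z (y + r y'), and [L k] is the part of p^k z that is linear in y'. *)
pose p : {poly B} := (z * y)%:P + (z * y')%:P * 'X.
pose L k := (p ^+ k * z%:P)`_1.
have p0 : p`_0 = z * y by rewrite coefD coefMX coefC addr0.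
have p1 : p`_1 = z * y' by rewrite coefD coefMX !coefC add0r.
have pk0 k : (p ^+ k * z%:P)`_0 = (z * y) ^+ k * z.
  by elim: k => [|k IHk];
    rewrite ?mul1r ?coefC // !exprS -!mulrA coef0M IHk p0 !mulrA.
have LS k : L k.+1 = z * y * L k + z * y' * ((z * y) ^+ k * z).
  by rewrite /L exprS -mulrA coefM1 pk0 p0 p1.
(* Since L N starts with z, it is killed by (z y)^(N+1) on its left. *)
have [M LM] : exists M, L N = z * M.
  case: (N) => [|n]; first by exists 0; rewrite /L mul1r coefC mulr0.
  by exists (y * L n + y' * ((z * y) ^+ n * z)); rewrite LS mulrDr !mulrA.
have LN : L N.+1 = 0.
  apply: (@poly_coef_in _ _ (GRing.in_alg B) _ (fun x => x = 0) [::]) => //.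
  - exact: in_alg_central.
  - by move=> x x' -> ->; rewrite addr0.
  - by move=> k x ->; rewrite mulr0.
  move=> r _; rewrite horner_algM hornerC.
  have -> : (p ^+ N.+1).[GRing.in_alg B r] = (z * (y + r *: y')) ^+ N.+1.
    elim: N.+1 => [|k IHk]; first by rewrite !expr0 hornerC.
    rewrite !exprS horner_algM IHk; congr (_ * _).
    rewrite /p hornerD horner_algM !hornerC hornerX mulrDr -scalerAr.
    by rewrite /GRing.in_alg /= -scalerAr mulr1.
  exact: nilz.
have := congr1 ( *%R ((z * y) ^+ N)) LN.
rewrite mulr0 LS LM mulrDr mulrA -exprSr [_ * (z * M)]mulrA nilz mul0r add0r =>
  <-.
by rewrite !mulrA.
Qed.

Lemma GI_semiprime_reduced (gens : B -> Prop) : generates gens ->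
  (forall x, gens x -> tangent x) -> GI_algebra B -> semiprime_ring B ->
  reduced_ring B.
Proof.
move=> genB tgens /(GI_divisibility Finf)[N divN] spB.
have annX (b c X : B) : tangent X -> b * c = 0 -> b * X * c = 0.
  move=> tX bc; apply: (@semiprime_bounded_nil _ N.+1 spB) => y.
  pose s := c * y * b.
  have ss : s * s = 0 by rewrite /s -!mulrA (mulrA b) bc mul0r !mulr0.
  have sP : s%:P * s%:P = 0 :> {poly B} by rewrite -polyCM ss.
  have f_neq0 : ('X ^+ 2 : {poly F}) != 0 by rewrite expf_neq0 ?polyX_eq0.
  have fE : ('X ^+ 2)^~ = 'X ^+ 2 :> {poly B} by rewrite /map_alg rmorphXn /=
    map_polyX.
  have sX : s%:P * 'X = 'X * s%:P :> {poly B} by rewrite commr_polyX.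
  have [||C] := divN X ('X + s%:P) ('X - s%:P) _ f_neq0 tX.
  - by rewrite fE mulrBr !mulrDl sP addr0 sX addrK.
  - by rewrite fE mulrBl !mulrDr sP addr0 sX addrK.
  (* At t = 0 the multiple of t^2 vanishes and t + s, t - s become s and - s, which leaves s (X s)^N
     = 0. *)
  move=> /(congr1 (fun p : {poly B} => p.[GRing.in_alg B 0])).
  rewrite fE !horner_algM hornerD !hornerX hornerC rmorph0 !mulr0 add0r.
  have altE c' n : exists2 k : F, k != 0 &
      (altcore ('X + s%:P) ('X - s%:P) X%:P c' n).[0] = k *: (X * s) ^+ n.
    have h0M (p p' : {poly B}) : (p * p').[0] = p.[0] * p'.[0].
      by have := horner_algM p p' 0; rewrite /GRing.in_alg /= scale0r.
    elim: n c' => [|n IHn] c' /=.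
      by exists 1; rewrite ?oner_neq0 // hornerC scale1r.
    have [k k_neq0 IHk] := IHn (~~ c'); exists (if c' then - k else k).
      by case: (c'); rewrite ?oppr_eq0.
    rewrite !h0M IHk hornerC exprS; case: c' {IHk} => /=.
      by rewrite hornerD hornerN hornerX hornerC sub0r mulrN mulNr -scalerAr
        scaleNr.
    by rewrite hornerD hornerX hornerC add0r -scalerAr.
  have [k k_neq0 ->] := altE true N; rewrite -scalerAr => sXs.
  have sXs0 : s * (X * s) ^+ N = 0.
    by apply: (scalerI k_neq0); rewrite sXs scaler0.
  have zE n : (b * X * c * y) ^+ n.+1 * (b * X * c) = b * X * (s * (X * s) ^+
    n) * (X * c).
    elim: n => [|n IHn]; first by rewrite expr1 mulr1 /s !mulrA.
    by rewrite exprS -mulrA IHn exprS /s !mulrA.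
  by rewrite zE sXs0 mulr0 mul0r.
have annB (b c : B) : b * c = 0 -> forall x, b * x * c = 0.
  move=> bc x.
  (* The left factor must vary: for a product x y, the hypothesis on y is applied to b' x. *)
  suff: forall b', b' * c = 0 -> b' * x * c = 0 by apply.
  move: x; apply: genB => [|x /tgens tx b']; last exact: annX.
  split=> [b'|x y IHx IHy b' b'c|x y IHx IHy b' b'c|k x IHx b' b'c].
  - by rewrite mulr1.
  - by rewrite mulrDr mulrDl IHx // IHy // addr0.
  - by rewrite mulrA IHy // IHx.
  - by rewrite -scalerAr -scalerAl IHx // scaler0.
by move=> x xx; apply: spB; exact: annB.
Qed.

End Reduced.

(** * Separable elements of reduced algebras are central *)

Section Centrality.
Variables (F : fieldType) (B : algType F).
Hypothesis Finf : infinite_field F.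
Local Notation "p ^~" := (map_alg B p) (at level 2, format "p ^~").

Lemma adDr (s x y : B) : ad s (x + y) = ad s x + ad s y.
Proof. by rewrite /ad mulrDr mulrDl opprD addrACA. Qed.

Lemma adDl (s x y : B) : ad (x + y) s = ad x s + ad y s.
Proof. by rewrite /ad mulrDr mulrDl opprD addrACA. Qed.

Lemma adZr k (s x : B) : ad s (k *: x) = k *: ad s x.
Proof. by rewrite /ad -scalerAl -scalerAr scalerBr. Qed.

Lemma ad0r (s : B) : ad s 0 = 0.
Proof. by rewrite /ad mulr0 mul0r subrr. Qed.

Lemma adC (x y : B) : ad y x = - ad x y.
Proof. by rewrite /ad opprB. Qed.

Lemma ad_mull (s x : B) : ad s (s * x) = s * ad s x.
Proof. by rewrite /ad mulrBr !mulrA. Qed.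

Lemma ad_mulr (s x : B) : ad s (x * s) = ad s x * s.
Proof. by rewrite /ad mulrBl !mulrA. Qed.

Section Root.
Variables (s : B) (f : {poly F}) (a : {poly B}) (b0 : F).
Hypothesis fa : f^~ = a * ('X - s%:P).
Hypothesis f' : f^`() = b0%:P.
Hypothesis b0_neq0 : b0 != 0.

Lemma root_poly_neq0 : f != 0.
Proof.
apply: contra_eq_neq f' => ->; rewrite deriv0 eq_sym polyC_eq0.
exact: b0_neq0.
Qed.

(** Comparing coefficients in f = a (t - s) gives a_j = f_(j+1) + a_(j+1) s. This is a downward
    induction from a_j = 0 for large j, and it exhibits the a_j as polynomials in s. *)
Lemma cofactor_ind (Q : B -> Prop) :
  Q 0 -> (forall k x, Q x -> Q (k%:A + x * s)) -> forall j, Q a`_j.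
Proof.
move=> Q0 QS; suff H n j : (size a <= j + n)%N -> Q a`_j.
  by move=> j; apply: (H (size a)); rewrite leq_addl.
elim: n j => [|n IHn] j; first by rewrite addn0 => ?; rewrite nth_default.
rewrite addnS -addSn => /IHn/(QS f`_j.+1); congr Q.
by rewrite -coef_map_alg fa mulrBr coefB coefMX coefMC /= subrK.
Qed.

Lemma cofactor_comm j : a`_j * s = s * a`_j.
Proof.
move: j; apply: (@cofactor_ind (fun x => x * s = s * x)) => [|k x xs];
  first by rewrite mul0r mulr0.
by rewrite mulrDl mulrDr -scalerAl -scalerAr mul1r mulr1 mulrA -xs.
Qed.

Lemma cofactorC : ('X - s%:P) * a = f^~.
Proof.
rewrite fa mulrBr mulrBl commr_polyX; congr (_ - _).
by apply/polyP => i; rewrite coefCM coefMC cofactor_comm.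
Qed.

Lemma root_s : (f^~).[s] = 0.
Proof. by rewrite fa hornerM_comm /comm_poly hornerXsubC subrr ?mul0r ?mulr0.
  Qed.

(* [Psi / f'(s)] is the projection of B onto the centralizer of s along
   [ad s B]. *)
Definition Psi (y : B) : B := (a * y%:P).[s].

Lemma PsiE y : Psi y = \sum_(j < size a) a`_j * y * s ^+ j.
Proof.
rewrite /Psi (@horner_coef_wide _ (size a)).
  by apply: eq_bigr => j _; rewrite coefMC.
apply/leq_sizeP => j /(nth_default 0) aj.
by rewrite coefMC aj mul0r.
Qed.

Lemma PsiD x y : Psi (x + y) = Psi x + Psi y.
Proof. by rewrite /Psi polyCD mulrDr hornerD. Qed.

Lemma PsiZ k x : Psi (k *: x) = k *: Psi x.
Proof.
by rewrite !PsiE scaler_sumr; apply: eq_bigr => j _;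
  rewrite -scalerAr -scalerAl.
Qed.

Lemma PsiN x : Psi (- x) = - Psi x.
Proof. by rewrite -scaleN1r PsiZ scaleN1r. Qed.

Lemma Psi0 : Psi 0 = 0.
Proof. by rewrite /Psi mulr0 horner0. Qed.

Lemma Psi_mulr y : Psi (y * s) = Psi y * s.
Proof.
rewrite !PsiE mulr_suml; apply: eq_bigr => j _.
by rewrite mulrA -!mulrA -exprS -exprSr.
Qed.

Lemma Psi_mull y : Psi (s * y) = s * Psi y.
Proof.
rewrite !PsiE mulr_sumr; apply: eq_bigr => j _.
by rewrite !mulrA cofactor_comm.
Qed.

(** Evaluate (t - s) a y = f y at t = s, with coefficients on the left: one side gives Psi y s - s
    Psi y, the other y f(s) = 0. *)
Lemma Psi_comm y : Psi y * s = s * Psi y.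
Proof.
apply/eqP; rewrite -subr_eq0; apply/eqP.
have : (('X - s%:P) * (a * y%:P)).[s] = 0.
  rewrite mulrA cofactorC map_alg_central hornerM_comm /comm_poly root_s //.
    by rewrite mulr0.
  by rewrite mulr0 mul0r.
by rewrite mulrBl -commr_polyX hornerD hornerN hornerMX hornerCM.
Qed.

Lemma Psi_ad y : Psi (ad s y) = 0.
Proof. by rewrite PsiD PsiN Psi_mull Psi_mulr Psi_comm subrr. Qed.

(** Differentiate f = a (t - s) and put t = s. *)
Lemma cofactor_root : a.[s] = b0%:A.
Proof.
have := congr1 (fun p : {poly B} => p^`().[s]) fa.
rewrite /map_alg deriv_map f' map_polyC hornerC => /= ->.
rewrite derivM derivB derivX derivC subr0 mulr1 hornerD hornerM_comm.
  by rewrite hornerXsubC subrr mulr0 add0r.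
by rewrite /comm_poly hornerXsubC subrr mulr0 mul0r.
Qed.

Lemma Psi1 : Psi 1 = b0%:A.
Proof. by rewrite /Psi mulr1 cofactor_root. Qed.

Lemma multiple_transfer (p y q : {poly B}) :
  multiple f (y - q) -> multiple f (p * y - p * q).
Proof. by rewrite -mulrBr; exact: multipleMl. Qed.

Lemma multiple_trans (p q r : {poly B}) :
  multiple f (p - q) -> multiple f (q - r) -> multiple f (p - r).
Proof. by rewrite -[p - r](subrKA q); exact: multipleD. Qed.

Lemma XcofactorE j : multiple f ('X^j * a - (s ^+ j)%:P * a).
Proof.
elim: j => [|j IHj]; first by rewrite subrr; exact: multiple0.
rewrite exprS exprSr polyCM -!mulrA;
  apply: (multiple_trans (multiple_transfer _ IHj)).
rewrite mulrA -commr_polyX -mulrA -mulrBr; apply: multipleMl.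
by exists 1; rewrite mul1r -cofactorC mulrBl.
Qed.

(** Move the powers of t in the first factor next to the second one, where t acts as s because (t -
    s) a = f. *)
Lemma cofactor_collapse y : multiple f (a * y%:P * a - (Psi y)%:P * a).
Proof.
have -> : a * y%:P * a = \sum_(j < size a) (a`_j * y)%:P * ('X^j * a).
  rewrite -[X in X * _ * _]coefK poly_def !mulr_suml.
  apply: eq_bigr => j _; rewrite -mul_polyC polyCM -!mulrA; congr (_ * _).
  by rewrite !mulrA commr_polyXn.
rewrite PsiE rmorph_sum mulr_suml -sumrB; apply: multiple_sum => j _.
rewrite /= (polyCM (a`_j * y)) -[X in _ - X]mulrA;
  apply/multiple_transfer/XcofactorE.
Qed.

Hypothesis redB : reduced_ring B.
Hypothesis GI : GI_algebra B.

(** Let W = X (t - s) X a and Y = X [X, s]. Since X (t - s) X = X^2 (t - s) + Y, one has W = Y a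
    modulo f, hence a W^m = Psi(Y)^m a by [cofactor_collapse]. The group identity makes a W^m vanish
    modulo f; at t = s this reads b0 Psi(Y)^m = 0. *)
Lemma Psi_quadratic X : tangent X -> Psi (X * ad X s) = 0.
Proof.
move=> tX; have [N divN] := GI_divisibility Finf GI.
have := divN X a ('X - s%:P) f root_poly_neq0 tX (esym fa) cofactorC.
pose b : {poly B} := 'X - s%:P; rewrite -/b.
pose W := X%:P * b * (X%:P * a).
(* A product of odd length is completed to a power of W by one more factor X a; the induction
   advances by two letters. *)
have altW n : (exists E m, altcore a b X%:P true n * E = W ^+ m) /\
              (exists E m, altcore a b X%:P true n.+1 * E = W ^+ m).
  elim: n => [|n [IHn IHn1]].
    split; first by exists 1, 0%N; rewrite mulr1.
    by exists (X%:P * a), 1%N; rewrite /= mulr1.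
  split=> //; have [E [m IHE]] := IHn; exists E, m.+1.
  by rewrite exprS -IHE /= /W !mulrA.
have [E [m HE]] := (altW N).1.
move=> /(multipleMr E); rewrite -mulrA HE => aWm.
pose Y := X * ad X s.
have aW : multiple f (a * W - (Psi Y)%:P * a).
  apply: multiple_trans (cofactor_collapse Y).
  rewrite -[a * _ * a]mulrA; apply: multiple_transfer.
  have -> : W - Y%:P * a = X%:P * X%:P * (b * a) .
    rewrite /W /Y /ad polyCM polyCB !polyCM /b !mulrBr !mulrBl !mulrBr !mulrA.
    by rewrite -[_ * 'X * X%:P]mulrA -commr_polyX !mulrA opprB subrKA.
  by apply: multipleMl; exists 1; rewrite mul1r cofactorC.
have aWmE n : multiple f (a * W ^+ n - ((Psi Y) ^+ n)%:P * a).
  elim: n => [|n IHn]; first by rewrite mulr1 mul1r subrr; exact: multiple0.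
  rewrite exprS mulrA exprS polyCM -[X in _ - X]mulrA.
  apply: multiple_trans (multiple_transfer _ IHn).
  by rewrite mulrA -mulrBl; apply: multipleMr.
have [C] : multiple f ((Psi Y ^+ m)%:P * a).
  rewrite -[_ * a](subKr (a * W ^+ m)); exact: multipleB.
move=> /(congr1 (fun p : {poly B} => p.[s])).
rewrite hornerCM cofactor_root [in RHS]hornerM_comm /comm_poly root_s;
  last first.
  by rewrite mulr0 mul0r.
rewrite mulr0 -scalerAr mulr1 => /(congr1 ( *:%R b0^-1)).
rewrite scalerA mulVf // scale1r scaler0; exact: reduced_nilpotent.
Qed.

Lemma Psi_polar X Y : tangent X -> tangent Y ->
  Psi (X * ad Y s) + Psi (Y * ad X s) = 0.
Proof.
move=> tX tY; have := Psi_quadratic (tangentD tX tY).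
rewrite adDl mulrDr !mulrDl !PsiD !Psi_quadratic // add0r addr0 addrC.
by [].
Qed.

(* Comparing the polarized identity for [ad s Y] and for [ad s Y * s]. *)
Lemma Psi_ad_ad2 X Y : tangent X -> tangent Y ->
  Psi (ad s Y * ad s (ad s X)) = 0.
Proof.
move=> tX tY; pose Z := ad s Y.
have tZ : tangent Z.
  by rewrite -[Z]mulr1 -(expr0 s);
    exact: ad_powers_tangent root_poly_neq0 root_s tY.
have tZs : tangent (Z * s).
  by rewrite -(expr1 s); exact: ad_powers_tangent root_poly_neq0 root_s tY.
have e1 := congr1 (fun y : B => y * s) (Psi_polar tX tZ).
have e2 := Psi_polar tX tZs.
rewrite /= mulrDl mul0r -!Psi_mulr in e1.
have adZs : ad (Z * s) s = ad Z s * s by rewrite adC ad_mulr -mulNr -adC.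
rewrite adZs mulrA -e1 in e2; move/addrI: e2 => e2.
have -> : ad s (ad s X) = ad X s * s - s * ad X s.
  by rewrite (adC X s) /ad !mulrN mulNr opprK addrC.
by rewrite mulrBr PsiD PsiN !mulrA e2 subrr.
Qed.

(** The F[s]-subbimodules of B. *)
Definition bimodule (Q : B -> Prop) :=
  [/\ Q 0, forall x y, Q x -> Q y -> Q (x + y), forall k x, Q x -> Q (k *: x),
      forall x, Q x -> Q (s * x) & forall x, Q x -> Q (x * s)].

(** Since b0 = Psi 1, the difference is the sum of the a_j [s^j, y], and each term lies in the
    F[s]-bimodule generated by [s, y]. *)
Lemma Psi_mod (Q : B -> Prop) y : bimodule Q -> Q (ad s y) ->
  Q (b0 *: y - Psi y).
Proof.
move=> [Q0 QD QZ Ql Qr] Qy.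
have Qa j x : Q x -> Q (a`_j * x).
  move: x; move: j.
  apply: (@cofactor_ind (fun c => forall x, Q x -> Q (c * x))) => [x _|k c IHc
    x Qx].
    by rewrite mul0r.
  rewrite mulrDl -scalerAl mul1r -mulrA; apply: QD; first exact: QZ.
  exact/IHc/Ql.
have Qad j : Q (ad (s ^+ j) y).
  elim: j => [|j IHj]; first by rewrite /ad mul1r mulr1 subrr.
  have -> : ad (s ^+ j.+1) y = s * ad (s ^+ j) y + ad s y * s ^+ j.
    by rewrite /ad mulrBr mulrBl exprS !mulrA subrKA.
  apply: QD; first exact: Ql.
  by elim: j {IHj} => [|j IHj]; rewrite ?mulr1 // exprSr mulrA; exact: Qr.
have -> : b0 *: y - Psi y = \sum_(j < size a) a`_j * ad (s ^+ j) y.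
  have -> : b0 *: y = Psi 1 * y by rewrite Psi1 -scalerAl mul1r.
  rewrite !PsiE mulr_suml -sumrB; apply: eq_bigr => j _.
  by rewrite mulr1 /ad mulrBr !mulrA.
by apply: (big_ind Q) => // j _; exact/Qa/Qad.
Qed.

Lemma Psi_mod0 (Q : B -> Prop) y : bimodule Q -> Psi y = 0 -> Q (ad s y) -> Q y.
Proof.
move=> bQ py /(Psi_mod bQ); rewrite py subr0 => Qy; case: bQ => _ _ QZ _ _.
by have := QZ b0^-1 _ Qy; rewrite scalerA mulVf // scale1r.
Qed.

Definition image (Q : B -> Prop) y := exists2 z, Q z & y = ad s z.

Lemma image_bimodule (Q : B -> Prop) : bimodule Q -> bimodule (image Q).
Proof.
move=> [Q0 QD QZ Ql Qr]; split.
- by exists 0; rewrite ?ad0r.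
- by move=> _ _ [x Qx ->] [y Qy ->]; exists (x + y); rewrite ?adDr //;
    exact: QD.
- by move=> k _ [x Qx ->]; exists (k *: x); rewrite ?adZr //; exact: QZ.
- by move=> _ [x Qx ->]; exists (s * x); rewrite ?ad_mull //; exact: Ql.
- by move=> _ [x Qx ->]; exists (x * s); rewrite ?ad_mulr //; exact: Qr.
Qed.

(* The largest right F[s]-submodule of the tangent space. *)
Definition stable_tangent Z := forall j, tangent (Z * s ^+ j).

Lemma stable_tangent_bimodule : bimodule stable_tangent.
Proof.
split.
- by move=> j; rewrite mul0r; exact: tangent0.
- by move=> x y tx ty j; rewrite mulrDl; exact: tangentD.
- by move=> k x tx j; rewrite -scalerAl; exact: tangentZ.
- move=> x tx j.
  have -> : s * x * s ^+ j = ad s (x * s ^+ j) + x * s ^+ j.+1.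
    by rewrite /ad exprSr !mulrA subrK.
  apply: tangentD; last exact: tx.
  apply: tangent_ad => //.
  exact: algebraic_tangent root_poly_neq0 root_s.
- by move=> x tx j; rewrite -mulrA -exprS.
Qed.

(** The space N. In the model case of a diagonal matrix s, Psi Z = 0 says that the blocks of Z on
    the eigenspaces of s vanish. *)
Definition off_diagonal Z := stable_tangent Z /\ Psi Z = 0.

Lemma off_diagonal_bimodule : bimodule off_diagonal.
Proof.
have [P0 PD PZ Pl Pr] := stable_tangent_bimodule; split.
- by split=> //; rewrite Psi0.
- by move=> x y [tx px] [ty py]; split; [exact: PD|rewrite PsiD px py addr0].
- by move=> k x [tx px]; split; [exact: PZ|rewrite PsiZ px scaler0].
- by move=> x [tx px]; split; [exact: Pl|rewrite Psi_mull px mulr0].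
- by move=> x [tx px]; split; [exact: Pr|rewrite Psi_mulr px mul0r].
Qed.

Lemma off_diagonal_ad Y : tangent Y -> off_diagonal (ad s Y).
Proof.
move=> tY; split=> [j|]; last exact: Psi_ad.
exact: ad_powers_tangent root_poly_neq0 root_s tY.
Qed.

Lemma off_diagonal_tangent Z : off_diagonal Z -> tangent Z.
Proof. by move=> [/(_ 0%N)]; rewrite mulr1. Qed.

Lemma off_diagonal_image Z : off_diagonal Z -> image stable_tangent Z.
Proof.
move=> [tZ pZ]; apply: Psi_mod0 pZ _.
  exact/image_bimodule/stable_tangent_bimodule.
by exists Z.
Qed.

(** An element killed by Psi lies in every bimodule that contains its bracket with s, so preimages
    under [ad s] can be taken repeatedly. [Psi_ad_ad2] asks for two in its second factor. *)
Lemma off_diagonal_image2 Z : off_diagonal Z -> image (image stable_tangent) Z.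
Proof.
move=> oZ; apply: Psi_mod0 oZ.2 _.
  exact/image_bimodule/image_bimodule/stable_tangent_bimodule.
by exists Z => //; exact: off_diagonal_image.
Qed.

Lemma Psi_off_diagonalM Z Z' : off_diagonal Z -> off_diagonal Z' ->
  Psi (Z * Z') = 0.
Proof.
move=> /off_diagonal_image[Y tY ->] /off_diagonal_image2[_ [X tX ->] ->].
by apply: Psi_ad_ad2; [have := tX 0%N|have := tY 0%N]; rewrite mulr1.
Qed.

(** Tangency of a product is not immediate, but [s, m m'] = [m' s, m] - [m', s m] is built from
    brackets of tangents. As Psi kills Z Z', [Psi_mod0] recovers Z Z' from [s, Z Z']. *)
Lemma off_diagonalM Z Z' : off_diagonal Z -> off_diagonal Z' ->
  off_diagonal (Z * Z').
Proof.
have [O0 OD OZ Ol Or] := off_diagonal_bimodule.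
have tad m m' : off_diagonal m -> off_diagonal m' -> tangent (ad s (m * m')).
  move=> om om'.
  have -> : ad s (m * m') = ad (m' * s) m - ad m' (s * m).
    by rewrite /ad opprB [RHS]addrC !mulrA subrKA.
  by apply: tangentB; apply: tangent_ad => //;
    apply: off_diagonal_tangent => //;
     [exact: Or|exact: Ol].
move=> oZ oZ'; split; last exact: Psi_off_diagonalM.
apply: Psi_mod0 (Psi_off_diagonalM oZ oZ') _;
  first exact: stable_tangent_bimodule.
move=> j; have -> : ad s (Z * Z') * s ^+ j = ad s (Z * (Z' * s ^+ j)).
  elim: j => [|j IHj]; first by rewrite !mulr1.
  by rewrite exprSr !mulrA IHj -ad_mulr !mulrA.
apply: tad => //.
by elim: j => [|j IHj]; rewrite ?mulr1 // exprSr mulrA; exact: Or.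
Qed.

Lemma off_diagonal_centralizer y : off_diagonal y -> ad s y = 0 -> y = 0.
Proof.
move=> oy sy; apply: (@Psi_mod0 (fun x => x = 0) y) oy.2 sy.
split=> // [x z -> ->|k x ->|x ->|x ->].
- by rewrite addr0.
- by rewrite scaler0.
- by rewrite mulr0.
- by rewrite mul0r.
Qed.

(* f(s + r x) commutes with s + r x and its coefficients in r are off-diagonal,
   so they vanish one after the other; the last one is x ^+ deg f. *)
Lemma off_diagonal0 x : off_diagonal x -> x = 0.
Proof.
move=> ox; have [O0 OD OZ Ol Or] := off_diagonal_bimodule.
pose S : {poly B} := s%:P + x%:P * 'X.
have S_coef0 k : (S ^+ k)`_0 = s ^+ k.
  elim: k => [|k IHk]; first by rewrite !expr0 coefC.
  by rewrite !exprS coef0M IHk coefD coefMX coefC addr0.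
have S_coefS k j : (S ^+ k.+1)`_j.+1 = s * (S ^+ k)`_j.+1 + x * (S ^+ k)`_j.
  rewrite exprS mulrDl coefD coefCM; congr (_ + _).
  by rewrite -mulrA -commr_polyX mulrA coefMX coefCM.
have S_off k j : off_diagonal (S ^+ k)`_j.+1.
  elim: k j => [|k IHk] j; first by rewrite expr0 coefC.
  rewrite S_coefS; apply: OD; first exact/Ol/IHk.
  case: j => [|j]; last exact: off_diagonalM.
  rewrite S_coef0; elim: k {IHk} => [|k IHk]; first by rewrite mulr1.
  by rewrite exprSr mulrA; exact: Or.
have S_high k j : (k < j)%N -> (S ^+ k)`_j = 0.
  elim: k j => [|k IHk] [|j] //; first by rewrite expr0 coefC.
  by rewrite ltnS => kj; rewrite S_coefS !IHk ?mulr0 ?addr0 // ltnW.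
have S_top k : (S ^+ k)`_k = x ^+ k.
  elim: k => [|k IHk]; first by rewrite expr0 coefC.
  by rewrite S_coefS IHk S_high // mulr0 add0r exprS.
pose G := \sum_(k < size f) (f`_k)%:A%:P * S ^+ k.
have GE j : G`_j = \sum_(k < size f) f`_k *: (S ^+ k)`_j.
  rewrite coef_sum; apply: eq_bigr => k _.
  by rewrite coefCM -scalerAl mul1r.
have GS : S * G = G * S.
  rewrite mulr_sumr mulr_suml; apply: eq_bigr => k _.
  rewrite mulrA -[RHS]mulrA -exprSr exprS [in RHS]mulrA; congr (_ * _).
  by apply/polyP => i; rewrite coefMC coefCM; rewrite -in_alg_central.
have G0 j : G`_j = 0.
  elim: j => [|j IHj].
    transitivity (f^~).[s]; last exact: root_s.
    rewrite GE (@horner_coef_wide _ (size f)) ?size_map_poly //.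
    by apply: eq_bigr => k _; rewrite S_coef0 coef_map_alg -scalerAl mul1r.
  apply: off_diagonal_centralizer.
    by rewrite GE; apply: (big_ind off_diagonal) => // k _; exact/OZ/S_off.
  (* This coefficient of S G = G S reads [s, G_(j+1)] + [x, G_j] = 0. *)
  have := congr1 (fun p : {poly B} => p`_j.+1) GS.
  rewrite mulrDl mulrDr !coefD coefCM coefMC -mulrA -commr_polyX mulrA.
  by rewrite mulrA !coefMX /= coefCM coefMC IHj mulr0 mul0r !addr0 /ad => ->;
    rewrite subrr.
have f_neq0 := root_poly_neq0; have := G0 (size f).-1; rewrite GE.
have -> : size f = (size f).-1.+1 by rewrite prednK // size_poly_gt0.
rewrite big_ord_recr /= big1 ?add0r => [|k _]; last by rewrite S_high ?scaler0.
rewrite S_top => /(congr1 ( *:%R (lead_coef f)^-1)).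
rewrite scalerA mulVf ?lead_coef_eq0 // scale1r scaler0.
exact: reduced_nilpotent.
Qed.

End Root.

Lemma GI_separable_central (s X : B) (f : {poly F}) (b0 : F) :
  reduced_ring B -> GI_algebra B -> (f^~).[s] = 0 -> f^`() = b0%:P -> b0 != 0 ->
  tangent X -> s * X = X * s.
Proof.
move=> redB GI /eqP/factor_theorem[a fa] f' b0_neq0 tX.
apply/eqP; rewrite -subr_eq0 -/(ad s X); apply/eqP.
exact: (off_diagonal0 fa f' b0_neq0 redB GI (off_diagonal_ad fa f' b0_neq0 tX)).
Qed.

End Centrality.

(** * The locally nilpotent radical *)

Section LocallyNilpotentRadical.
Variables (F : fieldType) (A : algType F).

Definition ideal (I : A -> Prop) :=
  [/\ I 0, forall x y, I x -> I y -> I (x + y), forall a x, I x -> I (a * x)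
    & forall a x, I x -> I (x * a)].

Fixpoint products (n : nat) (s : seq A) : seq A :=
  if n is n'.+1 then [seq x * y | x <- s, y <- products n' s] else [:: 1].

Lemma productsD m n s x : x \in products (m + n) s ->
  exists y z, [/\ y \in products m s, z \in products n s & x = y * z].
Proof.
elim: m x => [|m IHm] x /=.
  by move=> xs; exists 1, x; rewrite mul1r inE eqxx.
case/allpairsP => -[u v] /= [us /IHm[y [z [ym zn ->]]] ->].
exists (u * y), z; split=> //; last by rewrite mulrA.
by apply/allpairsP; exists (u, y).
Qed.

Lemma products_products m n s x : x \in products (n * m) s ->
  x \in products n (products m s).
Proof.
elim: n x => [|n IHn] x //; rewrite mulSn => /productsD[y [z [ym zn ->]]].
by apply/allpairsP; exists (y, z); split=> //; exact: IHn.
Qed.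

(** Vanishing of all products of length N amounts to nilpotence of the nonunital subalgebra
    generated by s. *)
Definition locally_nilpotent (I : A -> Prop) := forall s : seq A,
  (forall x, x \in s -> I x) -> exists N, forall x, x \in products N s -> x = 0.

(** A product of length N k regroups into N blocks of length k, each of them in I. *)
Lemma locally_nilpotent_ext (I J : A -> Prop) : locally_nilpotent I ->
  (forall s : seq A, (forall x, x \in s -> J x) ->
     exists k, forall x, x \in products k s -> I x) -> locally_nilpotent J.
Proof.
move=> nilI JI s /JI[k /nilI[N zN]]; exists (N * k)%N => x.
by move/products_products; exact: zN.
Qed.

Definition ideal_sum (I J : A -> Prop) x := exists y z, [/\ I y, J z & x = y +
  z].

Lemma ideal_sum_ideal I J : ideal I -> ideal J -> ideal (ideal_sum I J).
Proof.
move=> [I0 ID Il Ir] [J0 JD Jl Jr]; split.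
- by exists 0, 0; rewrite addr0.
- move=> _ _ [y [z [Iy Jz ->]]] [y' [z' [Iy' Jz' ->]]].
  by exists (y + y'), (z + z'); rewrite addrACA; split; [exact: ID|exact: JD|].
- move=> a _ [y [z [Iy Jz ->]]]; exists (a * y), (a * z).
  by rewrite mulrDr; split; [exact: Il|exact: Jl|].
- move=> a _ [y [z [Iy Jz ->]]]; exists (y * a), (z * a).
  by rewrite mulrDl; split; [exact: Ir|exact: Jr|].
Qed.

(** Modulo I the entries of s may be replaced by elements of J, whose long products vanish; so long
    products of s fall into I. *)
Lemma ideal_sum_nilpotent I J : ideal I -> locally_nilpotent I ->
  locally_nilpotent J -> locally_nilpotent (ideal_sum I J).
Proof.
move=> idI nilI nilJ; apply: locally_nilpotent_ext nilI _ => s sIJ.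
have [I0 ID Il Ir] := idI.
have [t [tJ st]] : exists t : seq A, (forall x, x \in t -> J x) /\
    forall x, x \in s -> exists2 y, y \in t & I (x - y).
  elim: s sIJ => [|x s IHs] sIJ; first by exists [::].
  have [|t [tJ st]] := IHs; first by move=> y ys; apply: sIJ;
    rewrite inE ys orbT.
  have [y [z [Iy Jz xE]]] := sIJ x (mem_head _ _).
  exists (z :: t); split=> [w|w]; rewrite inE => /predU1P[->|] //;
    first exact: tJ.
    by exists z; rewrite ?mem_head // xE addrK.
  by move=> /st[w' w't Iw]; exists w' => //; rewrite inE w't orbT.
have [N zN] := nilJ t tJ; exists N.
suff H n x : x \in products n s -> exists2 y, y \in products n t & I (x - y).
  by move=> x /H[y /zN ->]; rewrite subr0.
elim: n x => [|n IHn] x /=.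
  by rewrite inE => /eqP ->; exists 1; rewrite ?inE ?subrr.
case/allpairsP => -[u v] /= [/st[u' u't Iu] /IHn[v' v't Iv] ->].
exists (u' * v'); first by apply/allpairsP; exists (u', v').
by rewrite -(subrKA (u * v')) -mulrBl -mulrBr; apply: ID; [exact: Il|exact: Ir].
Qed.

(** The Levitzki radical. *)
Definition radical x := exists I, [/\ ideal I, locally_nilpotent I & I x].

Lemma radical_seq (s : seq A) : (forall x, x \in s -> radical x) ->
  exists I, [/\ ideal I, locally_nilpotent I & forall x, x \in s -> I x].
Proof.
elim: s => [|x s IHs] rs.
  exists (fun x => x = 0); split=> //.
    split=> // [x y -> ->|a x ->|a x ->].
    - by rewrite addr0.
    - by rewrite mulr0.
    - by rewrite mul0r.
  move=> s s0; exists 1%N => x /allpairsP[[u v]] /= [/s0 -> _ ->].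
  by rewrite mul0r.
have [|I [idI nilI sI]] := IHs; first by move=> y ys; apply: rs;
  rewrite inE ys orbT.
have [J [idJ nilJ Jx]] := rs x (mem_head _ _).
have [I0 _ _ _] := idI; have [J0 _ _ _] := idJ.
exists (ideal_sum I J); split; first exact: ideal_sum_ideal.
  exact: ideal_sum_nilpotent.
move=> y; rewrite inE => /predU1P[->|/sI Iy].
  by exists 0, x; rewrite add0r.
by exists y, 0; rewrite addr0.
Qed.

Lemma radical_nilpotent : locally_nilpotent radical.
Proof. by move=> s /radical_seq[I [_ nilI sI]]; exact: nilI. Qed.

Lemma radical_ideal : ideal radical.
Proof.
split.
- have [|I [idI nilI _]] := @radical_seq [::]; first by [].
  by exists I; split=> //; case: idI.
- move=> x y rx ry; have [|I [idI nilI sI]] := @radical_seq [:: x; y].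
    by move=> z; rewrite !inE => /orP[] /eqP ->.
  exists I; split=> //; have [_ ID _ _] := idI.
  by apply: ID; apply: sI; rewrite !inE eqxx ?orbT.
- move=> a x [I [idI nilI Ix]]; exists I; split=> //.
  by have [_ _ Il _] := idI; exact: Il.
- move=> a x [I [idI nilI Ix]]; exists I; split=> //.
  by have [_ _ _ Ir] := idI; exact: Ir.
Qed.

(** The ideal J = A x A satisfies J J inside the radical, so J is locally nilpotent by extension
    with k = 2. *)
Lemma radical_semiprime x : (forall y, radical (x * y * x)) -> radical x.
Proof.
move=> rx; have [R0 RD Rl Rr] := radical_ideal.
pose J y := exists t : seq (A * A), y = \sum_(c <- t) c.1 * x * c.2.
exists J; split; last by exists [:: (1, 1)]; rewrite big_seq1 mulr1 mul1r.
  split.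
  - by exists [::]; rewrite big_nil.
  - by move=> _ _ [t ->] [t' ->]; exists (t ++ t'); rewrite big_cat.
  - move=> a _ [t ->]; exists [seq (a * c.1, c.2) | c <- t].
    by rewrite big_map mulr_sumr; apply: eq_bigr => c _; rewrite /= !mulrA.
  - move=> a _ [t ->]; exists [seq (c.1, c.2 * a) | c <- t].
    by rewrite big_map mulr_suml; apply: eq_bigr => c _; rewrite /= !mulrA.
apply: locally_nilpotent_ext radical_nilpotent _ => s sJ; exists 2%N => z.
case/allpairsP => c [/sJ[t tE] /allpairsP[d [/sJ[t' t'E]]]].
rewrite inE => /eqP -> -> ->; rewrite mulr1 tE t'E {c d tE t'E}.
rewrite mulr_suml; apply: (big_ind radical) => // c _.
rewrite mulr_sumr; apply: (big_ind radical) => // c' _.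
rewrite !mulrA; apply: (Rr); rewrite -!mulrA; apply: (Rl).
by rewrite !mulrA -(mulrA x); exact: rx.
Qed.

Lemma radical1 : ~ radical 1.
Proof.
move=> r1; have [|N zN] := @radical_nilpotent [:: 1].
  by move=> x; rewrite inE => /eqP ->.
have : (1 : A) \in products N [:: 1].
  elim: N {zN} => [|n IHn]; first by rewrite /= inE.
  by apply/allpairsP; exists (1, 1); rewrite mem_head mulr1.
by move/zN/eqP; rewrite oner_eq0.
Qed.

Lemma radical_pow x : radical x -> exists N, x ^+ N = 0.
Proof.
move=> rx; have [|N zN] := @radical_nilpotent [:: x].
  by move=> y; rewrite inE => /eqP ->.
exists N; apply: zN; elim: N => [|n IHn]; first by rewrite /= inE.
by apply/allpairsP; exists (x, x ^+ n); rewrite mem_head exprS.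
Qed.

Lemma radical_unit x : radical (x - 1) -> exists y, x * y = 1 /\ y * x = 1.
Proof.
move=> rx; have [R0 RD Rl Rr] := radical_ideal.
have [N zN] : exists N, (1 - x) ^+ N = 0.
  by apply: radical_pow; rewrite -opprB -mulN1r; exact: Rl.
exists (\sum_(i < N) (1 - x) ^+ i); set S := \sum_(i < N) _.
have Sx : GRing.comm x S.
  apply: commr_sum => i _; apply: commrX; apply: commrB; last by [].
  exact: commr1.
have xS : x * S = 1.
  have := subrX1 (1 - x) N; rewrite zN sub0r => /(congr1 -%R).
  by rewrite opprK -mulNr opprB opprB addrC subrK => ->.
by split; rewrite -?Sx.
Qed.

End LocallyNilpotentRadical.

(** * Quotients and perfect fields *)

Section QuotientAlgebra.
Variables (F : fieldType) (A : algType F) (I : A -> Prop).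
Hypothesis idI : ideal I.
Hypothesis I1 : ~ I 1.

Definition congruent (x y : A) : bool := `[< I (x - y) >].

Lemma congruent_equiv : equiv_class_of congruent.
Proof.
have [I0 ID Il Ir] := idI.
have sym x y : congruent x y -> congruent y x.
  by move=> /asboolP xy; apply/asboolP; rewrite -opprB -mulN1r; exact: Il.
split.
- by move=> x; apply/asboolP; rewrite subrr.
- by move=> x y; apply/idP/idP; exact: sym.
- move=> y x z /asboolP xy /asboolP yz; apply/asboolP.
  by rewrite -(subrKA y); exact: ID.
Qed.

Canonical congruent_equivRel := EquivRelPack congruent_equiv.

Definition quotient := {eq_quot congruent_equivRel}%qT.
HB.instance Definition _ := Choice.on quotient.
HB.instance Definition _ := Quotient.on quotient.

Definition proj (x : A) : quotient := (\pi_quotient x)%qT.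

Lemma projP x y : proj x = proj y <-> I (x - y).
Proof. by split=> [/eqquotP /asboolP //|xy]; apply/eqquotP/asboolP. Qed.

Lemma proj_repr (a : quotient) : proj (repr a) = a.
Proof. exact: reprK. Qed.

Lemma repr_proj x : I (repr (proj x) - x).
Proof. by apply/projP; rewrite proj_repr. Qed.

Lemma proj_surj (a : quotient) : exists x, a = proj x.
Proof. by exists (repr a); rewrite proj_repr. Qed.

Definition qopp (a : quotient) := proj (- repr a).
Definition qadd (a b : quotient) := proj (repr a + repr b).
Definition qmul (a b : quotient) := proj (repr a * repr b).
Definition qscale (k : F) (a : quotient) := proj (k *: repr a).

Lemma qoppE x : qopp (proj x) = proj (- x).
Proof.
have [_ _ Il _] := idI; apply/projP.
by rewrite -opprD -mulN1r; apply/Il/repr_proj.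
Qed.

Lemma qaddE x y : qadd (proj x) (proj y) = proj (x + y).
Proof.
have [_ ID _ _] := idI; apply/projP.
by rewrite opprD addrACA; apply: ID; exact: repr_proj.
Qed.

Lemma qmulE x y : qmul (proj x) (proj y) = proj (x * y).
Proof.
have [_ ID Il Ir] := idI; apply/projP.
rewrite -(subrKA (x * repr (proj y))) -mulrBl -mulrBr.
by apply: ID; [apply: Ir|apply: Il]; exact: repr_proj.
Qed.

Lemma qscaleE k x : qscale k (proj x) = proj (k *: x).
Proof.
have [_ _ Il _] := idI; apply/projP.
by rewrite -scalerBr -mulr_algl; apply/Il/repr_proj.
Qed.

Let qE := (qoppE, qaddE, qmulE, qscaleE).

Lemma qaddA : associative qadd.
Proof.
move=> a b c; have [[x ->] [y ->] [z ->]] := And3 (proj_surj a) (proj_surj b)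
  (proj_surj c).
by rewrite !qE addrA.
Qed.
Lemma qaddC : commutative qadd.
Proof.
by move=> a b; have [[x ->] [y ->]] := conj (proj_surj a) (proj_surj b);
  rewrite !qE addrC.
Qed.
Lemma qadd0 : left_id (proj 0) qadd.
Proof. by move=> a; have [x ->] := proj_surj a; rewrite !qE add0r. Qed.
Lemma qaddN : left_inverse (proj 0) qopp qadd.
Proof. by move=> a; have [x ->] := proj_surj a; rewrite !qE addNr. Qed.
HB.instance Definition _ := GRing.isZmodule.Build quotient qaddA qaddC qadd0
  qaddN.

Lemma qmulA : associative qmul.
Proof.
move=> a b c; have [[x ->] [y ->] [z ->]] := And3 (proj_surj a) (proj_surj b)
  (proj_surj c).
by rewrite !qE mulrA.
Qed.
Lemma qmul1l : left_id (proj 1) qmul.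
Proof. by move=> a; have [x ->] := proj_surj a; rewrite !qE mul1r. Qed.
Lemma qmul1r : right_id (proj 1) qmul.
Proof. by move=> a; have [x ->] := proj_surj a; rewrite !qE mulr1. Qed.
Lemma qmulDl : left_distributive qmul qadd.
Proof.
move=> a b c; have [[x ->] [y ->] [z ->]] := And3 (proj_surj a) (proj_surj b)
  (proj_surj c).
by rewrite !qE mulrDl.
Qed.
Lemma qmulDr : right_distributive qmul qadd.
Proof.
move=> a b c; have [[x ->] [y ->] [z ->]] := And3 (proj_surj a) (proj_surj b)
  (proj_surj c).
by rewrite !qE mulrDr.
Qed.
Lemma qone_neq0 : proj 1 != proj 0.
Proof. by apply/eqP => /projP; rewrite subr0. Qed.
HB.instance Definition _ := GRing.Zmodule_isNzRing.Build quotient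
  qmulA qmul1l qmul1r qmulDl qmulDr qone_neq0.

Lemma qscaleA j k v : qscale j (qscale k v) = qscale (j * k) v.
Proof. by have [x ->] := proj_surj v; rewrite !qE scalerA. Qed.
Lemma qscale1 : left_id 1 qscale.
Proof. by move=> v; have [x ->] := proj_surj v; rewrite !qE scale1r. Qed.
Lemma qscaleDr : right_distributive qscale +%R.
Proof.
move=> k a b; have [[x ->] [y ->]] := conj (proj_surj a) (proj_surj b).
by rewrite /GRing.add /= !qE scalerDr.
Qed.
Lemma qscaleDl v : {morph qscale^~ v : j k / j + k}.
Proof.
move=> j k; have [x ->] := proj_surj v.
by rewrite [RHS]/GRing.add /= !qE scalerDl.
Qed.
HB.instance Definition _ := GRing.Zmodule_isLmodule.Build F quotient
  qscaleA qscale1 qscaleDr qscaleDl.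

Lemma qscaleAl (k : F) (a b : quotient) : k *: (a * b) = (k *: a) * b.
Proof.
have [[x ->] [y ->]] := conj (proj_surj a) (proj_surj b).
by rewrite /GRing.mul /GRing.scale /= !qE scalerAl.
Qed.
HB.instance Definition _ := GRing.Lmodule_isLalgebra.Build F quotient qscaleAl.
Lemma qscaleAr (k : F) (a b : quotient) : k *: (a * b) = a * (k *: b).
Proof.
have [[x ->] [y ->]] := conj (proj_surj a) (proj_surj b).
by rewrite /GRing.mul /GRing.scale /= !qE scalerAr.
Qed.
HB.instance Definition _ := GRing.Lalgebra_isAlgebra.Build F quotient qscaleAr.

Lemma proj_linear : linear proj.
Proof. by move=> k x y; rewrite -qaddE -qscaleE. Qed.
Lemma proj_monoid : monoid_morphism proj.
Proof. by split=> // x y; rewrite -qmulE. Qed.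
HB.instance Definition _ := GRing.isLinear.Build F A quotient *:%R proj
  proj_linear.
HB.instance Definition _ := GRing.isMonoidMorphism.Build A quotient proj
  proj_monoid.

Lemma quotient_algebra : exists (B : algType F) (pi : {lrmorphism A -> B}),
  (forall b, exists a, b = pi a) /\ (forall a, pi a = 0 <-> I a).
Proof.
exists quotient, proj; split=> [b|a]; first exact: proj_surj.
by rewrite -[0]/(proj 0) -[a in I a]subr0; exact: projP.
Qed.

End QuotientAlgebra.

Section LiftGroupIdentity.
Variables (F : fieldType) (A B : algType F) (pi : {lrmorphism A -> B}).
Hypothesis pi_surj : forall b, exists a, b = pi a.
Hypothesis ker_pi : forall a, pi a = 0 <-> radical a.

(** Both x y and y x are 1 modulo the radical, hence units. So x has a right inverse y w and a left
    inverse w' y, and these agree. *)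
Lemma lift_unit x y : pi x * pi y = 1 -> pi y * pi x = 1 ->
  exists z, [/\ x * z = 1, z * x = 1 & pi z = pi y].
Proof.
move=> xy yx.
have ru u v : pi u * pi v = 1 -> exists w, u * v * w = 1 /\ w * (u * v) = 1.
  move=> uv; apply: radical_unit; apply/ker_pi.
  by rewrite rmorphB rmorphM rmorph1 uv subrr.
have [w [xyw _]] := ru _ _ xy; have [w' [_ yxw']] := ru _ _ yx.
have zE : y * w = w' * y.
  by rewrite -[LHS]mul1r -yxw' -[RHS]mulr1 -xyw !mulrA.
exists (y * w); split; first by rewrite mulrA.
  by rewrite zE -mulrA.
by rewrite -[LHS]mul1r -yx -mulrA -rmorphM mulrA xyw rmorph1 mulr1.
Qed.

Lemma GI_quotient : GI_algebra A -> GI_algebra B.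
Proof.
move=> [n [w [w0 rw GI]]]; exists n, w; split=> // g ginv gg.
have /choice[h hP] : forall i, exists c : A * A,
    [/\ c.1 * c.2 = 1, c.2 * c.1 = 1, pi c.1 = g i & pi c.2 = ginv i].
  move=> i; have [x xE] := pi_surj (g i); have [y yE] := pi_surj (ginv i).
  have [ggi gig] := gg i; rewrite xE yE in ggi gig.
  by have [z [xz zx zy]] := lift_unit ggi gig; exists (x, z); rewrite /= xE yE.
have hw := GI (fun i => (h i).1) (fun i => (h i).2).
transitivity (pi (word_eval (fun i => (h i).1) (fun i => (h i).2) w)).
  rewrite rmorph_prod; apply: eq_bigr => a _.
  by case: (hP a.1) => _ _ <- <-; case: ifP.
by rewrite hw ?rmorph1 // => i; case: (hP i).
Qed.

Lemma semiprime_quotient : semiprime_ring B.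
Proof.
move=> b; have [a ->] := pi_surj b => bb; apply/ker_pi.
apply: radical_semiprime => y; apply/ker_pi.
by rewrite !rmorphM; exact: bb.
Qed.

Lemma generates_quotient (G : A -> Prop) : generates G ->
  generates (fun b => exists2 a, G a & b = pi a).
Proof.
move=> genG T [T1 TD TM TZ] GT b; have [a ->] := pi_surj b.
move: a; apply: genG => [|x Gx]; last by apply: GT; exists x.
split=> [|x y|x y|k x].
- by rewrite rmorph1.
- by rewrite rmorphD; exact: TD.
- by rewrite rmorphM; exact: TM.
- by rewrite linearZ; exact: TZ.
Qed.

End LiftGroupIdentity.

Section PerfectField.
Variables (F : fieldType) (p : nat) (B : algType F).
Hypothesis pF : p \in [pchar F].
Hypothesis perfF : perfect_char F p.
Local Notation "p ^~" := (map_alg B p) (at level 2, format "p ^~").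

Definition p_polynomial n (a : nat -> F) : {poly F} :=
  \sum_(i < n) a i *: 'X^(p ^ i).

(** If a_0 is nonzero, the derivative is the constant a_0. Otherwise p-th roots of the coefficients
    give f = g^p with a shorter p-polynomial g, and g(s)^p = 0 forces g(s) = 0 in a reduced ring. *)
Lemma separable_p_polynomial (s : B) n (a : nat -> F) : reduced_ring B ->
  (exists2 i, (i < n)%N & a i != 0) -> ((p_polynomial n a)^~).[s] = 0 ->
  exists (f : {poly F}) (b0 : F),
    [/\ (f^~).[s] = 0, f^`() = b0%:P & b0 != 0].
Proof.
move=> redB; elim: n a => [|n IHn] a [i]; first by [].
move=> lt_in ai; have [a0|a0] := eqVneq (a 0%N) 0; last first.
  move=> fs; exists (p_polynomial n.+1 a), (a 0%N); split=> //.
  rewrite /p_polynomial raddf_sum big_ord_recl /= big1 => [|j _].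
    by rewrite addr0 derivZ expn0 derivX alg_polyC.
  by rewrite derivZ derivXn expnSr mulrnA mulrn_pchar ?pchar_poly // scaler0.
have /choice[r rP] := perfF.
have pP : p \in [pchar {poly F}] by rewrite pchar_poly.
pose b i := r (a i.+1).
have -> : p_polynomial n.+1 a = p_polynomial n b ^+ p.
  rewrite -(pFrobenius_autE pP) rmorph_sum /p_polynomial big_ord_recl a0
    scale0r add0r.
  apply: eq_bigr => j _; rewrite /= pFrobenius_autE exprZn rP -exprM.
  by rewrite mulnC -expnS.
move=> gs; apply: (IHn b).
  case: i lt_in ai => [|i] lt_in ai; first by rewrite a0 eqxx in ai.
  exists i => //; apply: contra ai => /eqP bi.
  have := rP (a i.+1); rewrite -/(b i) bi expr0n => <-.
  by have /andP[/prime_gt0 p_gt0 _] := pF; rewrite eqn0Ngt p_gt0.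
apply: (@reduced_nilpotent _ _ p) => //.
rewrite -[(_^~).[s]]/(horner_alg s (p_polynomial n b)) -rmorphXn.
exact: gs.
Qed.

End PerfectField.

(** * Local finiteness *)

Section CommutatorsInRadical.
Variables (F : fieldType) (p : nat).
Hypothesis Finf : infinite_field F.
Hypothesis pF : p \in [pchar F].
Hypothesis perfF : perfect_char F p.

Definition p_algebraic (A : algType F) (x : A) := exists n (a : nat -> F),
  (exists2 i, (i < n)%N & a i != 0) /\ (map_alg A (p_polynomial p n a)).[x] = 0.

Lemma p_polynomial_neq0 n (a : nat -> F) :
  (exists2 i, (i < n)%N & a i != 0) -> p_polynomial p n a != 0.
Proof.
have p_gt1 : (1 < p)%N by have /andP[/prime_gt1] := pF.
move=> [i lt_in]; apply: contra_neq => /(congr1 (fun f : {poly F} => f`_(p ^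
  i))).
rewrite coef0 coef_sum (bigD1 (Ordinal lt_in)) //= coefZ coefXn eqxx mulr1.
rewrite big1 ?addr0 // => j ji; rewrite coefZ coefXn eqn_exp2l //.
by rewrite eq_sym -[_ == _]/(j == Ordinal lt_in) (negbTE ji) mulr0.
Qed.

Lemma horner_alg_morph (A B : algType F) (pi : {lrmorphism A -> B}) (f : {poly
  F}) x :
  (map_alg B f).[pi x] = pi (map_alg A f).[x].
Proof.
rewrite -horner_map /map_alg -map_poly_comp; congr (_.[_]).
by apply: eq_map_poly => k /=; rewrite linearZ rmorph1.
Qed.

Lemma GI_commutator_radical (A : algType F) (G : A -> Prop) :
  generates G -> (forall x, G x -> p_algebraic x) -> GI_algebra A ->
  forall x y : A, radical (x * y - y * x).
Proof.
move=> genG Galg GI x y.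
have [B [pi [pi_surj ker_pi]]] := quotient_algebra (radical_ideal A) (@radical1
  F A).
have genB := generates_quotient pi_surj genG.
have GIB := GI_quotient pi_surj ker_pi GI.
have Balg b : (exists2 a, G a & b = pi a) -> p_algebraic b.
  move=> [a /Galg[n [c [c0 ca]]] ->]; exists n, c; split=> //.
  by rewrite horner_alg_morph ca rmorph0.
have Btan b : (exists2 a, G a & b = pi a) -> tangent b.
  by move=> /Balg[n [c [/p_polynomial_neq0 c0]]]; exact: algebraic_tangent.
have redB : reduced_ring B.
  have sp := semiprime_quotient pi_surj ker_pi.
  exact (GI_semiprime_reduced Finf genB Btan GIB sp).
have central_sub (s : B) : subalgebra_pred (fun b => s * b = b * s).
  split=> [|u v su sv|u v su sv|k u su].
  - by rewrite mulr1 mul1r.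
  - by rewrite mulrDr mulrDl su sv.
  - by rewrite mulrA su -mulrA sv mulrA.
  - by rewrite -scalerAr -scalerAl su.
have gen_central s b : (exists2 a, G a & s = pi a) -> s * b = b * s.
  move=> Gs; move: b; apply: (genB _ (central_sub s)) => b Gb.
  have [n [c [c0 cs]]] := Balg _ Gs.
  have [f [b0 [fs f' b0_neq0]]] := separable_p_polynomial pF perfF redB c0 cs.
  exact (GI_separable_central Finf redB GIB fs f' b0_neq0 (Btan b Gb)).
have comB (s b : B) : s * b = b * s.
  by move: b; apply: (genB _ (central_sub s)) => b Gb; rewrite (gen_central b).
by apply/ker_pi; rewrite rmorphB !rmorphM comB subrr.
Qed.

End CommutatorsInRadical.

(** * Finitely spanned subspaces *)

Section Span.
Variables (F : fieldType) (V : lmodType F).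

Definition subspace (S : V -> Prop) :=
  [/\ S 0, forall x y, S x -> S y -> S (x + y) & forall k x, S x -> S (k *: x)].

Lemma subspaceB S x y : subspace S -> S x -> S y -> S (x - y).
Proof. by move=> [_ SD SZ] Sx Sy; rewrite -scaleN1r; apply: SD => //;
  exact: SZ. Qed.

Definition span (e : seq V) x :=
  exists c : nat -> F, x = \sum_(i < size e) c i *: e`_i.

Lemma span_subspace e : subspace (span e).
Proof.
split.
- by exists (fun _ => 0); rewrite big1 // => i _; rewrite scale0r.
- move=> _ _ [c ->] [d ->]; exists (fun i => c i + d i).
  by rewrite -big_split; apply: eq_bigr => i _; rewrite scalerDl.
- move=> k _ [c ->]; exists (fun i => k * c i).
  by rewrite scaler_sumr; apply: eq_bigr => i _; rewrite scalerA.
Qed.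

Lemma mem_span e x : x \in e -> span e x.
Proof.
move=> xe; exists (fun i => (i == index x e)%:R).
have lt_xe : (index x e < size e)%N by rewrite index_mem.
rewrite (bigD1 (Ordinal lt_xe)) //= eqxx scale1r nth_index // big1 ?addr0 //.
by move=> i /negbTE; rewrite -val_eqE /= => ->; rewrite scale0r.
Qed.

Lemma span_ind e S x :
  subspace S -> (forall y, y \in e -> S y) -> span e x -> S x.
Proof.
move=> [S0 SD SZ] eS [c ->]; apply: (big_ind S) => // i _.
by apply/SZ/eS; rewrite mem_nth.
Qed.

(** Induction on e. If S is not inside [span e], pick x0 in S outside it, with v-component k0;
    subtracting (k / k0) x0 moves any x of S with v-component k into the intersection of S and
    [span e]. *)
Lemma subspace_span S e : subspace S -> (forall x, S x -> span e x) ->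
  exists e', forall x, S x <-> span e' x.
Proof.
elim: e S => [|v e IHe] S sS Se.
  exists [::] => x; split=> [/Se //|].
  by apply: (span_ind sS).
have [S0 SD SZ] := sS; have [E0 ED EZ] := span_subspace e.
have [|x [Sx ex]|e' e'P] := IHe (fun x => S x /\ span e x).
- split=> // [x y [Sx ex] [Sy ey]|k x [Sx ex]].
    by split; [exact: SD|exact: ED].
  by split; [exact: SZ|exact: EZ].
- exact: ex.
have [Se'|] := pselect (forall x, S x -> span e x).
  by exists e' => x; rewrite -e'P; split=> [Sx|[]//]; split=> //; exact: Se'.
move=> /existsNP[x0 /not_implyP[Sx0 ex0]].
have split_v x : span (v :: e) x -> exists k, span e (x - k *: v).
  apply: (@span_ind _ (fun x => exists k, span e (x - k *: v))) => [|y].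
    split=> [|x1 y1 [k kx] [l ly]|l x1 [k kx]].
    - by exists 0; rewrite scale0r subr0.
    - by exists (k + l); rewrite scalerDl opprD addrACA; exact: ED.
    - by exists (l * k); rewrite -scalerA -scalerBr; exact: EZ.
  rewrite inE => /predU1P[->|ye]; first by exists 1; rewrite scale1r subrr.
  by exists 0; rewrite scale0r subr0; exact: mem_span.
have [k0 ek0] := split_v _ (Se _ Sx0).
have k0_neq0 : k0 != 0.
  by apply: contra_notN ex0 => /eqP k00; rewrite k00 scale0r subr0 in ek0.
exists (x0 :: e') => x; split=> [Sx|].
  have [k ek] := split_v _ (Se _ Sx).
  have [_ TD TZ] := span_subspace (x0 :: e').
  rewrite -[x](subrK ((k / k0) *: x0)); apply: (TD); last first.
    by apply/TZ/mem_span/mem_head.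
  suff : span e' (x - (k / k0) *: x0).
    apply: (span_ind (span_subspace _)).
    by move=> y ye; apply: mem_span; rewrite inE ye orbT.
  apply/e'P; split; first by apply: subspaceB => //; exact: SZ.
  have -> : x - (k / k0) *: x0 = (x - k *: v) - (k / k0) *: (x0 - k0 *: v).
    by rewrite scalerBr scalerA divfK // opprB addrA subrK.
  by apply: subspaceB => //; exact: EZ.
apply: (span_ind sS) => // y; rewrite inE => /predU1P[->//|/mem_span/e'P[]//].
Qed.

End Span.

Lemma span_map (F : fieldType) (V W : lmodType F) (g : V -> W) (e : seq V) S x :
  (forall y z, g (y + z) = g y + g z) -> (forall k y, g (k *: y) = k *: g y) ->
  subspace S -> (forall y, y \in e -> S (g y)) -> span e x -> S (g x).
Proof.
move=> gD gZ [S0 SD SZ]; apply: (@span_ind _ _ _ (fun y => S (g y))).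
split=> [|y z|k y].
- by rewrite -(scale0r 0) gZ scale0r.
- by rewrite gD; exact: SD.
- by rewrite gZ; exact: SZ.
Qed.

Section LocalFiniteness.
Variables (F : fieldType) (A : algType F).
Local Notation "p ^~" := (map_alg A p) (at level 2, format "p ^~").
Hypothesis comm_rad : forall x y : A, radical (x * y - y * x).

Definition algebraic (x : A) := exists2 f : {poly F}, f != 0 & (f^~).[x] = 0.

Lemma algebraic_pow x : algebraic x ->
  exists2 n, (0 < n)%N & span [seq x ^+ i | i <- iota 0 n] (x ^+ n).
Proof.
move=> [f f_neq0 fx]; pose d := (size f).-1.
have sizeE : size f = d.+1 by rewrite prednK // size_poly_gt0.
(* The relation x f(x) = 0 is used instead of f(x) = 0, so that the exponent is positive for every
   f. *)
exists d.+1 => //.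
have [E0 ED EZ] := span_subspace [seq x ^+ i | i <- iota 0 d.+1].
have : x * (f^~).[x] = 0 by rewrite fx mulr0.
rewrite (@horner_coef_wide _ d.+1); last by rewrite size_map_poly // sizeE.
rewrite big_ord_recr /= coef_map_alg mulrDr -scalerAl mul1r -scalerAr -exprS.
move/eqP; rewrite addrC addr_eq0 => /eqP lead.
have -> : x ^+ d.+1 = (lead_coef f)^-1 *: (f`_d *: x ^+ d.+1).
  by rewrite scalerA mulVf ?lead_coef_eq0 // scale1r.
rewrite lead; apply: (EZ); rewrite -scaleN1r; apply: (EZ); rewrite mulr_sumr.
apply: (big_ind (span _)) => // i _.
rewrite coef_map_alg -scalerAl mul1r -scalerAr -exprS; apply: (EZ).
apply: mem_span; apply/mapP; exists i.+1 => //.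
by rewrite mem_iota /= add0n ltnS.
Qed.

(** Modulo the radical the algebra is commutative, so E can consist of the ordered monomials in xs
    with bounded exponents. *)
Lemma finite_mod_radical (xs : seq A) : (forall x, x \in xs -> algebraic x) ->
  exists2 E : seq A, 1 \in E & forall x m, x \in xs -> m \in E ->
    exists2 y, span E y & radical (x * m - y).
Proof.
have [R0 RD Rl Rr] := radical_ideal A.
elim: xs => [|x xs IHxs] alg_xs; first by exists [:: 1]; rewrite ?mem_head.
have [|E E1 EP] := IHxs; first by move=> y ys; apply: alg_xs;
  rewrite inE ys orbT.
have [n n_gt0 xn] := algebraic_pow (alg_xs x (mem_head _ _)).
pose E' := [seq x ^+ i * m | i <- iota 0 n, m <- E].
have E'P i m : (i < n)%N -> m \in E -> x ^+ i * m \in E'.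
  by move=> lt_in mE; apply/allpairsP; exists (i, m); rewrite mem_iota.
exists E' => [|y m'].
  by rewrite -[1]mulr1 -{1}(expr0 x); exact: E'P.
rewrite inE => xs_y /allpairsP[[i m] /= [i_n mE ->]].
have lt_in : (i < n)%N by rewrite mem_iota in i_n.
case/predU1P: xs_y => [->|y_xs].
  exists (x * (x ^+ i * m)); last by rewrite subrr.
  rewrite mulrA -exprS; have [lt_i1n|] := ltnP i.+1 n.
    exact/mem_span/E'P.
  move=> le_ni1; have -> : i.+1 = n by apply/eqP; rewrite eqn_leq lt_in.
  apply: (span_map (g := fun z => z * m)) (span_subspace E') _ xn.
  - by move=> u v; rewrite mulrDl.
  - by move=> k u; rewrite -scalerAl.
  move=> _ /mapP[j j_n ->]; apply/mem_span/E'P => //.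
  by rewrite mem_iota in j_n.
have [z zE rz] := EP y m y_xs mE; exists (x ^+ i * z).
  apply: (span_map (g := fun z => x ^+ i * z)) (span_subspace E') _ zE.
  - by move=> u v; rewrite mulrDr.
  - by move=> k u; rewrite -scalerAr.
  by move=> u uE; exact/mem_span/E'P.
have -> : y * (x ^+ i * m) - x ^+ i * z
    = (y * x ^+ i - x ^+ i * y) * m + x ^+ i * (y * m - z).
  by rewrite mulrBl mulrBr !mulrA subrKA.
by apply: RD; [exact/Rr|exact: Rl].
Qed.

(* The words m c_1 ... c_k with m in E and c_i among finitely many errors, which
   generate a nilpotent algebra, span a space stable under the generators. *)
Lemma finite_stable_span (xs : seq A) : (forall x, x \in xs -> algebraic x) ->
  exists2 W : seq A, span W 1 &
    forall x v, x \in xs -> span W v -> span W (x * v).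
Proof.
move=> /finite_mod_radical[E E1 EP].
have /choice[g gP] : forall c : A * A, exists y, c.1 \in xs -> c.2 \in E ->
    span E y /\ radical (c.1 * c.2 - y).
  move=> [x m] /=; have [[xs_x mE]|nxm] := pselect (x \in xs /\ m \in E).
    by have [y] := EP x m xs_x mE; exists y.
  by exists 0 => xs_x mE; case: nxm.
pose C := [seq x * m - g (x, m) | x <- xs, m <- E].
have [|N zN] := @radical_nilpotent F A C.
  by move=> _ /allpairsP[[x m] /= [xs_x mE ->]]; exact: (gP (x, m) xs_x mE).2.
pose D := flatten [seq products k C | k <- iota 0 N.+1].
have DP k c : (k <= N)%N -> c \in products k C -> c \in D.
  move=> le_kN ck; apply/flattenP; exists (products k C) => //.
  by apply/mapP; exists k; rewrite // mem_iota.
pose W := [seq m * c | m <- E, c <- D].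
have WP m c : m \in E -> c \in D -> m * c \in W.
  by move=> mE cD; apply/allpairsP; exists (m, c).
have [W0 WD WZ] := span_subspace W.
exists W => [|x v xs_x].
  rewrite -[1]mulr1; apply/mem_span/WP => //.
  by apply: (@DP 0%N); rewrite //= inE.
apply: (span_map (g := fun z => x * z)) (span_subspace W) _.
- by move=> u w; rewrite mulrDr.
- by move=> k u; rewrite -scalerAr.
move=> _ /allpairsP[[m c] /= [mE /flattenP[_ /mapP[k k_N ->] ck] ->]].
have {k_N} le_kN : (k <= N)%N by rewrite mem_iota in k_N.
have [gE _] := gP (x, m) xs_x mE.
(* In x m c = (x m - g) c + g c, the first term is 1 in E times a longer product of errors, zero
   once k reaches N; the second keeps c and stays in the span of E times c. *)
rewrite mulrA -[x * m](subrK (g (x, m))) mulrDl; apply: WD; last first.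
  apply: (span_map (g := fun z => z * c)) (span_subspace W) _ gE.
  - by move=> u w; rewrite mulrDl.
  - by move=> j u; rewrite -scalerAl.
  by move=> u uE; apply/mem_span/WP => //; exact: DP ck.
have cC : (x * m - g (x, m)) * c \in products k.+1 C.
  apply/allpairsP; exists (x * m - g (x, m), c); split=> //=.
  by apply/allpairsP; exists (x, m).
have [lt_kN|le_Nk] := ltnP k N.
  by rewrite -[_ * c]mul1r; apply/mem_span/WP => //; exact: DP cC.
suff -> : (x * m - g (x, m)) * c = 0 by [].
by rewrite (zN c) ?mulr0 //; have -> : N = k by apply/eqP;
  rewrite eqn_leq le_Nk.
Qed.

Lemma generates_locally_finite (G : A -> Prop) : generates G ->
  (forall x, G x -> algebraic x) -> locally_finite A.
Proof.
move=> genG Galg s.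
(* Finitely many generators already produce all of s. *)
have [xs xsG xsP] : exists2 xs : seq A, (forall x, x \in xs -> G x) &
    forall T, subalgebra_pred T -> (forall x, x \in xs -> T x) ->
      forall x, x \in s -> T x.
  have fin x : exists2 xs : seq A, (forall y, y \in xs -> G y) &
      forall T, subalgebra_pred T -> (forall y, y \in xs -> T y) -> T x.
    move: x; apply: genG => [|x Gx]; last first.
      exists [:: x] => [y|T _]; first by rewrite inE => /eqP ->.
      by apply; rewrite mem_head.
    split.
    - by exists [::] => // T [].
    - move=> x y [xs xsG xsP] [ys ysG ysP]; exists (xs ++ ys) => [z|T sT zT].
        by rewrite mem_cat => /orP[/xsG|/ysG].
      have [_ TD _ _] := sT; apply: TD; [apply: xsP|apply: ysP] => // z zs;
      by apply: zT; rewrite mem_cat zs ?orbT.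
    - move=> x y [xs xsG xsP] [ys ysG ysP]; exists (xs ++ ys) => [z|T sT zT].
        by rewrite mem_cat => /orP[/xsG|/ysG].
      have [_ _ TM _] := sT; apply: TM; [apply: xsP|apply: ysP] => // z zs;
      by apply: zT; rewrite mem_cat zs ?orbT.
    - move=> k x [xs xsG xsP]; exists xs => // T sT xsT.
      by have [_ _ _ TZ] := sT; apply: TZ; exact: xsP.
  elim: s => [|x s [xs xsG xsP]]; first by exists [::].
  have [ys ysG ysP] := fin x; exists (ys ++ xs) => [z|T sT zT z].
    by rewrite mem_cat => /orP[/ysG|/xsG].
  rewrite inE => /predU1P[->|zs].
    by apply: ysP => // y yys; apply: zT; rewrite mem_cat yys.
  by apply: (xsP T) => // y yxs; apply: zT; rewrite mem_cat yxs orbT.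
have [W W1 WP] := finite_stable_span (fun x xxs => Galg x (xsG x xxs)).
have [W0 WD WZ] := span_subspace W.
(* T contains the subalgebra generated by s; applying its elements to 1 puts that subalgebra inside
   [span W]. *)
pose T x := forall v, span W v -> span W (x * v).
have sT : subalgebra_pred T.
  split=> [v|x y Tx Ty v Wv|x y Tx Ty v Wv|k x Tx v Wv].
  - by rewrite mul1r.
  - by rewrite mulrDl; apply: WD; [exact: Tx|exact: Ty].
  - by rewrite -mulrA; exact/Tx/Ty.
  - by rewrite -scalerAl; exact/WZ/Tx.
have [T1 TD TM TZ] := sT.
set S := smallest _ _.
have SW x : S x -> span W x.
  move=> Sx; suff /(_ 1 W1) : T x by rewrite mulr1.
  apply: (Sx T); split=> [|y]; last exact: xsP sT (fun z zxs v => WP z v zxs) y.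
  split=> [|k u v|u v].
  - exact/mem_set.
  - move=> /set_mem Tu /set_mem Tv; apply/mem_set.
    by apply: TD => //; exact: TZ.
  - by move=> /set_mem Tu /set_mem Tv; apply/mem_set; exact: TM.
have sS : subspace S.
  have Slin k x y : S x -> S y -> S (k *: x + y).
    move=> Sx Sy M [[M1 Mlin MM] sM]; apply/set_mem/Mlin; apply/mem_set.
      by apply: Sx.
    by apply: Sy.
  have S0 : S 0.
    move=> M [[M1 Mlin MM] sM]; apply/set_mem.
    by have := Mlin (-1) 1 1 M1 M1; rewrite scaleN1r addNr.
  split=> // [x y Sx Sy|k x Sx]; first by have := Slin 1 x y Sx Sy;
    rewrite scale1r.
  by have := Slin k x 0 Sx S0; rewrite addr0.
have [e eP] := subspace_span sS SW; exists e.
by apply/seteqP; split=> x /eP.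
Qed.

End LocalFiniteness.

Theorem GI_locally_finite (p : nat) (F : fieldType) (A : algType F)
    (G : A -> Prop) :
  infinite_field F -> p \in [pchar F] -> perfect_char F p ->
  generates G -> (forall x, G x -> p_algebraic p x) -> GI_algebra A ->
  locally_finite A.
Proof.
move=> Finf pF perfF genG Galg GI.
apply: (generates_locally_finite _ genG) => [x y|x /Galg[n [a [a0 ax]]]].
  exact (GI_commutator_radical Finf pF perfF genG Galg GI x y).
by exists (p_polynomial p n a) => //; exact: p_polynomial_neq0.
Qed.

(** * Generators of the restricted enveloping algebra *)

Section EnvelopingAlgebra.
Variables (F : fieldType) (p : nat) (L : restrictedLieType F p).
Hypothesis p_gt0 : (0 < p)%N.
Variables (U : algType F) (iota : {linear L -> U}).
Hypothesis hU : restricted_enveloping iota.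

(* U is isomorphic to the quotient [uenv] of the algebra of terms in L. *)
Lemma enveloping_generates : generates (fun u => exists x, u = iota x).
Proof.
have [irep iuniv] := hU.
have [g [gi _]] := iuniv _ _ (uiota_rep L p_gt0).
have [j [_ jU]] := iuniv _ _ irep.
pose h := ulift_lrmorphism p_gt0 irep.
(* Both h g and the identity extend iota, so they agree by uniqueness; thus every u is the value of
   a term. *)
have hgU u : h (g u) = u.
  have hgj : (h \o g) =1 j.
    by apply: (jU (h \o g)) => x /=; rewrite gi; exact: (uliftE irep).
  have idj : idfun =1 j by exact: (jU idfun).
  by transitivity (j u); [exact: hgj|exact/esym/idj].
move=> T [T1 TD TM TZ] Tiota u; rewrite -[u]hgU.
case: (upi_surj (g u)) => t ->; rewrite /h /= (uliftE irep).
have T0 : T 0 by have := TZ 0 _ T1; rewrite scale0r.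
elim: t => [x|||t IH|t IHt v IHv|t IHt v IHv|c t IH] //=.
- by apply: Tiota; exists x.
- by rewrite -scaleN1r; exact: TZ.
- exact: TD.
- exact: TM.
- exact: TZ.
Qed.

(** The preimage under iota of a subalgebra of U is a restricted subalgebra, because iota turns
    brackets into commutators and the p-map into p-th powers. *)
Lemma enveloping_generates_from (X : L -> Prop) :
  smallest (@restricted_subalgebra F p L) X = [set: L]%classic ->
  generates (fun u => exists2 x, X x & u = iota x).
Proof.
have [[ilie ippow] _] := hU.
move=> genX T sT XT; have [T1 TD TM TZ] := sT.
apply: enveloping_generates => // _ [x ->].
have Sx : smallest (@restricted_subalgebra F p L) X x by rewrite genX.
apply: (Sx (fun y => T (iota y))); split=> [|y Xy]; last by apply: XT; exists y.
have TB u v : T u -> T v -> T (u - v).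
  by move=> Tu Tv; rewrite -scaleN1r; apply: TD => //; exact: TZ.
have TX u m : T u -> T (u ^+ m).
  by move=> Tu; elim: m => // m IHm; rewrite exprS; exact: TM.
split.
- split=> [|k y z].
    by apply/mem_set; rewrite /= linear0 -(scale0r 1); exact: TZ.
  move=> /set_mem Ty /set_mem Tz; apply/mem_set.
  by rewrite /= linearP; apply: TD => //; exact: TZ.
- by move=> y z Ty Tz; rewrite /= ilie; apply: TB; exact: TM.
- by move=> y Ty; rewrite /= ippow; exact: TX.
Qed.

(** The k-th iterate of the p-map becomes the power p^k in U, so a relation among iterates becomes a
    p-polynomial with root iota x. *)
Lemma p_algebraic_iota x : palgebraic x -> p_algebraic p (iota x).
Proof.
have [[_ ippow] _] := hU.
move=> [n [a [[i ai] ax]]]; pose b j := oapp a 0 (insub j : option 'I_n.+1).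
have bE (j : 'I_n.+1) : b j = a j by rewrite /b valK.
exists n.+1, b; split; first by exists i; rewrite ?bE.
have iter_ppow k : iota (iter k ppow x) = iota x ^+ (p ^ k).
  by elim: k => [|k IHk]; rewrite ?expr1 //= ippow IHk -exprM -expnSr.
transitivity (iota (\sum_(i < n.+1) a i *: iter i ppow x));
  last by rewrite ax linear0.
rewrite -[LHS]/(horner_alg (iota x) _) !raddf_sum; apply: eq_bigr => j _.
rewrite /= !linearZ /= iter_ppow bE rmorphXn -scalerAl mul1r /=.
by rewrite /horner_alg horner_morphX.
Qed.

End EnvelopingAlgebra.

Theorem theorem3p1 (p : nat) (F : fieldType) (hchar : p \in [pchar F]%R)
    (hinf : infinite_set [set: F]%classic) (hperf : perfect_char F p)
    (L : restrictedLieType F p) (hgen : algebraically_generated L)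
    (U : algType F) (iota : {linear L -> U}%R)
    (hU : restricted_enveloping iota) (hGI : GI_algebra U) :
  locally_finite U.
Proof.
have p_gt0 : (0 < p)%N by have /andP[/prime_gt0] := hchar.
have [X Xalg genX] := hgen.
have Finf : infinite_field F.
  move=> s; apply: contrapT => /forallNP sF; apply: hinf.
  have -> : [set: F]%classic = [set` s]%classic; last exact: finite_seq.
  by apply/seteqP; split=> x // _; apply/negPn/negP; exact: sF.
apply: GI_locally_finite Finf hchar hperf (enveloping_generates_from p_gt0 hU
  genX) _ hGI.
by move=> _ [x /Xalg xalg ->]; exact: p_algebraic_iota.
Qed.
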